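(* Let $n\ge 2$ and consider the Lobachevsky $(n+1)$-space with horospherical coordinates $(u,v^1,\dots,v^n)$ and metric $$ds^2=du^2+e^{2u}\left[(dv^1)^2+\dots+(dv^n)^2\right].$$ Let $X_0=\partial_u$ and $X_\alpha=e^{-u}\partial_{v^\alpha}$ for $\alpha=1,\dots,n$. Let $\theta\in[0,\pi/2]$ be constant and $$\xi=\cos\theta\,X_0+\sin\theta\cos u\,X_1+\sin\theta\sin u\,X_2 .$$ Then $\xi$ is a unit vector field of constant mean curvature. Namely, the components of the mean curvature vector of $\xi(M)\subset T_1M$ (with $M$ the Lobachevsky space), with respect to the orthonormal normal frame $\tilde n_1,\dots,\tilde n_n$ where $\tilde n_\sigma$ is the normalization of $-[(\nabla\xi)^*f_\sigma]^H+f_\sigma^V$ and $$f_1=-\sin\theta X_0+\cos\theta\cos u\,X_1+\cos\theta\sin u\,X_2,\quad f_2=-\sin u\,X_1+\cos u\,X_2,\quad f_\sigma=X_\sigma\ (\sigma\ge3),$$ are $$H_{1|}=\frac{n-2}{n+1}\,\frac{\sqrt2\,\sin\theta\cos\theta}{1+\cos^2\theta},\qquad H_{2|}=\frac{n\sqrt2\,\sin\theta}{2(n+1)},\qquad H_{\sigma|}=0\quad(\sigma\ge 3).$$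
   Context: $T_1M$ is the unit tangent sphere bundle with the Sasaki metric. With $\pi:TM\to M$ the projection and $K:T_{(Q,\xi)}TM\to T_QM$ the connection map, in induced coordinates $K\big(A^i\partial_{u^i}+B^i\partial_{\xi^i}\big)=(B^i+\Gamma^i_{jk}\xi^jA^k)\partial_{u^i}$, the Sasaki metric is $\langle\langle\tilde X,\tilde Y\rangle\rangle=\langle\pi_*\tilde X,\pi_*\tilde Y\rangle+\langle K\tilde X,K\tilde Y\rangle$, and $T_1M\subset TM$ has the induced metric. The horizontal lift $X^H$ and vertical lift $X^V$ of $X\in T_QM$ are determined by $\pi_*X^H=X,\ KX^H=0$ and $\pi_*X^V=0,\ KX^V=X$; all lifts are taken at $(Q,\xi(Q))$. A unit vector field $\xi$ on $M$ is regarded as a map $M\to T_1M$, with image the submanifold $\xi(M)$. $\nabla$ is the Levi-Civita connection of $M$; $(\nabla\xi)^*:\xi^\perp\to TM$ is defined by $\langle(\nabla\xi)^*X,Y\rangle=\langle X,\nabla_Y\xi\rangle$. For a unit normal $\tilde n_\sigma$ of $\xi(M)$ in $T_1M$, the component $H_{\sigma|}$ of the mean curvature vector is $\frac1{n+1}\mathrm{trace}\,\tilde\Omega_{\tilde n_\sigma}$, where $\tilde\Omega_{\tilde n_\sigma}(\tilde X,\tilde Y)=\langle\langle\tilde\nabla_{\tilde X}\tilde Y,\tilde n_\sigma\rangle\rangle$ and $\tilde\nabla$ is the Levi-Civita connection of $T_1M$. ''$\xi$ has constant mean curvature'' means that the mean curvature vector of $\xi(M)$ has constant components in this frame (hence constant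 length). *)

(* Defs.v *)
From HB Require Import structures.
From mathcomp Require Import all_boot all_order all_algebra.
From mathcomp Require Import all_classical all_reals all_analysis.
Set Implicit Arguments.
Unset Strict Implicit.
Unset Printing Implicit Defensive.
Import Order.TTheory GRing.Theory Num.Theory.
Import numFieldNormedType.Exports.
Local Open Scope classical_set_scope.
Local Open Scope ring_scope.

(* A Riemannian manifold M covered by one chart is R^(m.+1) with a
   matrix-valued metric g; points and tangent vectors of M are row vectors in
   the coordinates u^i.  TM has the induced coordinates (u^i, xi^i): a point of
   TM is a pair (Q, z) with z in T_Q M, and a tangent vector of TM at a point
   is the pair (A, B) standing for A^i d/du^i + B^i d/dxi^i. *)

Fixpoint Ck {R : realType} {V W : normedModType R} (k : nat) (f : V -> W) :
    Prop :=
  match k with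
  | 0 => continuous f
  | k'.+1 => (forall x, differentiable f x) /\
             (forall v, Ck k' (fun x => 'D_v f x))
  end.

Definition smooth {R : realType} {V W : normedModType R} (f : V -> W) : Prop :=
  forall k, Ck k f.

Definition pt (R : realType) (m : nat) : normedModType R := 'rV[R]_m.+1.
Definition tpt (R : realType) (m : nat) : normedModType R :=
  ('rV[R]_m.+1 * 'rV[R]_m.+1)%type.
Definition metric (R : realType) (m : nat) := pt R m -> 'M[R]_m.+1.

Definition ip {R : realType} {m : nat} (g : metric R m) (Q : pt R m)
    (x y : pt R m) : R :=
  (x *m g Q *m y^T) 0 0.

Definition partial {R : realType} {m : nat} (i : 'I_m.+1) (f : pt R m -> R^o)
    (Q : pt R m) : R :=
  'D_(delta_mx 0 i : pt R m) f Q.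

(* Gamma^i_{jk} *)
Definition christoffel {R : realType} {m : nat} (g : metric R m) (Q : pt R m)
    (i j k : 'I_m.+1) : R :=
  2^-1 * \sum_(l < m.+1) invmx (g Q) i l *
    (partial j (fun P => g P l k) Q + partial k (fun P => g P j l) Q
     - partial l (fun P => g P j k) Q).

(* Gamma^i_{jk} x^j y^k d/du^i *)
Definition Gam {R : realType} {m : nat} (g : metric R m) (Q : pt R m)
    (x y : pt R m) : pt R m :=
  \row_(i < m.+1) \sum_(j < m.+1) \sum_(k < m.+1)
    christoffel g Q i j k * x 0 j * y 0 k.

(* The Levi-Civita derivative of the field xi at Q in the direction y. *)
Definition nabla {R : realType} {m : nat} (g : metric R m)
    (xi : pt R m -> pt R m) (Q : pt R m) (y : pt R m) : pt R m :=
  'D_y xi Q + Gam g Q (xi Q) y.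

(* (nabla xi)^* x: the vector whose inner product with every y is
   <x, nabla_y xi>; see ip_adj_nabla for y in the coordinate basis. *)
Definition adj_nabla {R : realType} {m : nat} (g : metric R m)
    (xi : pt R m -> pt R m) (Q : pt R m) (x : pt R m) : pt R m :=
  (\row_(j < m.+1) ip g Q x (nabla g xi Q (delta_mx 0 j))) *m invmx (g Q).

Lemma ip_adj_nabla {R : realType} {m : nat} (g : metric R m)
    (xi : pt R m -> pt R m) (Q x : pt R m) (j : 'I_m.+1) :
  g Q \in unitmx ->
  ip g Q (adj_nabla g xi Q x) (delta_mx 0 j) =
  ip g Q x (nabla g xi Q (delta_mx 0 j)).
Proof.
by move=> gU; rewrite {1}/ip /adj_nabla mulmxKV// trmx_delta -colE !mxE.
Qed.

Definition dproj {R : realType} {m : nat} (a : tpt R m) : pt R m := a.1.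

Definition connmap {R : realType} {m : nat} (g : metric R m) (p a : tpt R m) :
    pt R m :=
  a.2 + Gam g p.1 p.2 a.1.

Definition sasaki {R : realType} {m : nat} (g : metric R m) (p a b : tpt R m) :
    R :=
  ip g p.1 (dproj a) (dproj b) + ip g p.1 (connmap g p a) (connmap g p b).

Definition hlift {R : realType} {m : nat} (g : metric R m) (p : tpt R m)
    (x : pt R m) : tpt R m :=
  (x, - Gam g p.1 p.2 x).

Definition vlift {R : realType} {m : nat} (g : metric R m) (p : tpt R m)
    (x : pt R m) : tpt R m :=
  (0, x).

Lemma connmap_hlift {R : realType} {m : nat} (g : metric R m) (p : tpt R m)
    (x : pt R m) : connmap g p (hlift g p x) = 0.
Proof. by rewrite /connmap /hlift /= addNr. Qed.

Lemma connmap_vlift {R : realType} {m : nat} (g : metric R m) (p : tpt R m)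
    (x : pt R m) : connmap g p (vlift g p x) = x.
Proof.
rewrite /connmap /vlift /=; apply/rowP => i; rewrite !mxE.
rewrite big1 ?addr0// => j _; rewrite big1// => k _.
by rewrite mxE mulr0.
Qed.

Definition sqnorm {R : realType} {m : nat} (g : metric R m) (p : tpt R m) :
    R^o :=
  ip g p.1 p.2 p.2.

Definition T1 {R : realType} {m : nat} (g : metric R m) (p : tpt R m) : Prop :=
  sqnorm g p = 1.

(* Tangency to the level set T1 at p. *)
Definition tangent_T1 {R : realType} {m : nat} (g : metric R m)
    (p a : tpt R m) : Prop :=
  'D_a (sqnorm g) p = 0.

(* Vector fields on T_1 M are represented by smooth extensions to TM (they
   exist since T_1 M is closed in TM), two extensions being identified when
   they agree on T_1 M; likewise for smooth functions. *)
Definition field_T1 {R : realType} {m : nat} (g : metric R m)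
    (X : tpt R m -> tpt R m) : Prop :=
  smooth X /\ forall p, T1 g p -> tangent_T1 g p (X p).

Definition eq_T1 {R : realType} {m : nat} (g : metric R m)
    (X Y : tpt R m -> tpt R m) : Prop :=
  forall p, T1 g p -> X p = Y p.

Definition bracket {R : realType} {m : nat} (X Y : tpt R m -> tpt R m)
    (p : tpt R m) : tpt R m :=
  'D_(X p) Y p - 'D_(Y p) X p.

(* D is the Levi-Civita connection of T_1 M with the metric induced by the
   Sasaki metric: the torsion-free metric affine connection. *)
Record levi_civita_T1 {R : realType} {m : nat} (g : metric R m)
    (D : (tpt R m -> tpt R m) -> (tpt R m -> tpt R m) -> tpt R m -> tpt R m) :
    Prop := LeviCivitaT1 {
  lc_field : forall X Y, field_T1 g X -> field_T1 g Y -> field_T1 g (D X Y);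
  lc_eq : forall X X' Y Y', field_T1 g X -> field_T1 g X' ->
    field_T1 g Y -> field_T1 g Y' ->
    eq_T1 g X X' -> eq_T1 g Y Y' -> eq_T1 g (D X Y) (D X' Y');
  lc_addl : forall X X' Y, field_T1 g X -> field_T1 g X' -> field_T1 g Y ->
    eq_T1 g (D (fun p => X p + X' p) Y) (fun p => D X Y p + D X' Y p);
  lc_scalel : forall (phi : tpt R m -> R^o) X Y, smooth phi ->
    field_T1 g X -> field_T1 g Y ->
    eq_T1 g (D (fun p => phi p *: X p) Y) (fun p => phi p *: D X Y p);
  lc_addr : forall X Y Y', field_T1 g X -> field_T1 g Y -> field_T1 g Y' ->
    eq_T1 g (D X (fun p => Y p + Y' p)) (fun p => D X Y p + D X Y' p);
  lc_leibniz : forall (phi : tpt R m -> R^o) X Y, smooth phi ->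
    field_T1 g X -> field_T1 g Y ->
    eq_T1 g (D X (fun p => phi p *: Y p))
            (fun p => 'D_(X p) phi p *: Y p + phi p *: D X Y p);
  lc_torsion : forall X Y, field_T1 g X -> field_T1 g Y ->
    eq_T1 g (fun p => D X Y p - D Y X p) (bracket X Y);
  lc_metric : forall X Y Z, field_T1 g X -> field_T1 g Y -> field_T1 g Z ->
    forall p, T1 g p ->
    'D_(X p) (fun q => sasaki g q (Y q) (Z q) : R^o) p =
      sasaki g p (D X Y p) (Z p) + sasaki g p (Y p) (D X Z p) }.

Definition unit_vector_field {R : realType} {m : nat} (g : metric R m)
    (xi : pt R m -> pt R m) : Prop :=
  smooth xi /\ forall Q, ip g Q (xi Q) (xi Q) = 1.

Definition sect {R : realType} {m : nat} (xi : pt R m -> pt R m) (Q : pt R m) :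
    tpt R m :=
  (Q, xi Q).

Definition dsect {R : realType} {m : nat} (xi : pt R m -> pt R m) (Q : pt R m)
    (y : pt R m) : tpt R m :=
  'D_y (sect xi) Q.

(* Fields on T_1 M extending the coordinate frame xi_* d/du^i of xi(M). *)
Definition frame_extension {R : realType} {m : nat} (g : metric R m)
    (xi : pt R m -> pt R m) (F : 'I_m.+1 -> tpt R m -> tpt R m) : Prop :=
  (forall i, field_T1 g (F i)) /\
  (forall i Q, F i (sect xi Q) = dsect xi Q (delta_mx 0 i)).

Definition Omega {R : realType} {m : nat} (g : metric R m)
    (D : (tpt R m -> tpt R m) -> (tpt R m -> tpt R m) -> tpt R m -> tpt R m)
    (p nu : tpt R m) (X Y : tpt R m -> tpt R m) : R :=
  sasaki g p (D X Y p) nu.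

(* (dim M)^-1 trace Omega_nu at sect xi Q, the trace being taken with respect
   to the metric of xi(M); here dim M = m.+1. *)
Definition mean_curv {R : realType} {m : nat} (g : metric R m)
    (D : (tpt R m -> tpt R m) -> (tpt R m -> tpt R m) -> tpt R m -> tpt R m)
    (xi : pt R m -> pt R m) (F : 'I_m.+1 -> tpt R m -> tpt R m)
    (Q : pt R m) (nu : tpt R m) : R :=
  let p := sect xi Q in
  (m.+1%:R)^-1 *
  \tr (invmx (\matrix_(i < m.+1, j < m.+1) sasaki g p (F i p) (F j p)) *m
       (\matrix_(i < m.+1, j < m.+1) Omega g D p nu (F i) (F j))).

Definition normal_lift {R : realType} {m : nat} (g : metric R m)
    (xi : pt R m -> pt R m) (f : pt R m -> pt R m) (Q : pt R m) : tpt R m :=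
  let p := sect xi Q in
  let w := - hlift g p (adj_nabla g xi Q (f Q)) + vlift g p (f Q) in
  (Num.sqrt (sasaki g p w w))^-1 *: w.

(* nu 1, ..., nu m is an orthonormal frame of the normal bundle of xi(M) in
   T_1 M (whose rank is m). *)
Definition orthonormal_normal_frame {R : realType} {m : nat} (g : metric R m)
    (xi : pt R m -> pt R m) (nu : nat -> pt R m -> tpt R m) : Prop :=
  forall (Q : pt R m) (s : nat), (1 <= s <= m)%N ->
    [/\ tangent_T1 g (sect xi Q) (nu s Q),
        forall y, sasaki g (sect xi Q) (nu s Q) (dsect xi Q y) = 0 &
        forall t : nat, (1 <= t <= m)%N ->
          sasaki g (sect xi Q) (nu s Q) (nu t Q) = (s == t)%:R].

Definition constant_mean_curvature {R : realType} {m : nat} (g : metric R m)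
    (D : (tpt R m -> tpt R m) -> (tpt R m -> tpt R m) -> tpt R m -> tpt R m)
    (xi : pt R m -> pt R m) (F : 'I_m.+1 -> tpt R m -> tpt R m)
    (nu : nat -> pt R m -> tpt R m) : Prop :=
  exists h : nat -> R, forall (Q : pt R m) (s : nat), (1 <= s <= m)%N ->
    mean_curv g D xi F Q (nu s Q) = h s.

(* Lobachevsky (n+1)-space; the coordinate of index 0 is u and that of index
   alpha >= 1 is v^alpha. *)
Definition horo_metric (R : realType) (n : nat) : metric R n :=
  fun Q => diag_mx (\row_(i < n.+1) if i == 0 then 1 else expR (2 * Q 0 0)).
Arguments horo_metric R n Q : clear implicits.

(* horoX k = X_k, for k <= n. *)
Definition horoX {R : realType} {n : nat} (k : nat) (Q : pt R n) : pt R n :=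
  if k == 0%N then delta_mx 0 0 else expR (- Q 0 0) *: delta_mx 0 (inord k).

Definition xi_theta {R : realType} {n : nat} (theta : R) (Q : pt R n) :
    pt R n :=
  cos theta *: horoX 0 Q + (sin theta * cos (Q 0 0)) *: horoX 1 Q
  + (sin theta * sin (Q 0 0)) *: horoX 2 Q.

(* f_s, for 1 <= s <= n. *)
Definition f_theta {R : realType} {n : nat} (theta : R) (s : nat)
    (Q : pt R n) : pt R n :=
  match s with
  | 1 => - sin theta *: horoX 0 Q + (cos theta * cos (Q 0 0)) *: horoX 1 Q
         + (cos theta * sin (Q 0 0)) *: horoX 2 Q
  | 2 => - sin (Q 0 0) *: horoX 1 Q + cos (Q 0 0) *: horoX 2 Q
  | _ => horoX s Q
  end.

Definition n_theta {R : realType} {n : nat} (theta : R) (s : nat)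
    (Q : pt R n) : tpt R n :=
  normal_lift (horo_metric R n) (xi_theta theta) (f_theta theta s) Q.

(* Main.v *)
(* In the coordinates of TM the Koszul formula expresses
   << D_X Y, Z >> through the directional derivative of Y along X and the first
   derivatives of the Sasaki metric.  It therefore depends on the extensions of
   the coordinate frame of xi(M) only through their values on xi(M), and any
   Levi-Civita connection of T_1 M gives the same second fundamental form.  The
   horospherical metric is homogeneous and xi has constant coordinates (cos theta,
   sin theta, 0, ..., 0) in the orthonormal frame X_0, cos u X_1 + sin u X_2,
   - sin u X_1 + cos u X_2, X_3, ..., X_n; in this frame all quantities become
   independent of Q and rational in cos theta, sin theta.  The trace is taken in a
   frame diagonalizing the induced metric 1 + (nabla xi)^T (nabla xi) of xi(M). *)
Require Import Defs.
From HB Require Import structures.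
From mathcomp Require Import all_boot all_order all_algebra.
From mathcomp Require Import all_classical all_reals all_analysis.
From mathcomp Require Import ring lra.
Import Order.TTheory GRing.Theory Num.Theory.
Import numFieldNormedType.Exports.
Local Open Scope ring_scope.

(** * Directional derivatives and smooth maps *)

(** Write E_1 = cos u X_1 + sin u X_2 and E_2 = - sin u X_1 + cos u X_2. The map nabla xi sends X_0
    to sin theta E_2, E_1 to cos theta E_1 - sin theta X_0, E_2 to cos theta E_2, and X_i with i >=
    3 to cos theta X_i. On the plane of X_0 and E_2 the matrix (nabla xi)^T (nabla xi) has rank one,
    so the induced metric has eigenvalue 1 on cos theta X_0 - sin theta E_2, eigenvalue 2 on E_1 and
    on sin theta X_0 + cos theta E_2, and eigenvalue 1 + cos^2 theta on the other n - 2 directions.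
    This is the origin of the frame [hE] and of the constants sqrt 2 and 1 + cos^2 theta. The
    connection [D] is an arbitrary operator on fields, and only extensions of the coordinate frame
    are given. Hence each normal vector is first extended to a field, the Koszul formula replaces
    [D] by an explicit bilinear form on T_Q M, and only then is the frame changed. *)

Definition dd {R : realType} {V W : normedModType R} (f : V -> W) (x v : V)
    (l : W) : Prop :=
  differentiable f x /\ 'D_v f x = l.

Lemma dd_eq {R : realType} {V W : normedModType R} {f g : V -> W} {x v : V}
    {l l' : W} : dd f x v l -> f =1 g -> l = l' -> dd g x v l'.
Proof. by move=> df /funext <- <-. Qed.

Lemma dd_diff {R : realType} {V W : normedModType R} (f : V -> W) (x v : V) :
  differentiable f x -> dd f x v ('D_v f x).
Proof. by []. Qed.

Lemma dd_cst {R : realType} {V W : normedModType R} (w : W) (x v : V) :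
  dd (fun=> w) x v 0.
Proof. by split; [exact: differentiable_cst|exact: derive_cst]. Qed.

Lemma dd_add {R : realType} {V W : normedModType R} {f g : V -> W} {x v : V}
    {l m : W} : dd f x v l -> dd g x v m -> dd (fun y => f y + g y) x v (l + m).
Proof.
move=> [df <-] [dg <-]; split; first exact: differentiableD.
by apply: deriveD; exact: diff_derivable.
Qed.

Lemma dd_sum {R : realType} {V W : normedModType R} {I : finType}
    {P : pred I} {f : I -> V -> W} {x v : V} {l : I -> W} :
  (forall i, dd (f i) x v (l i)) ->
  dd (fun y => \sum_(i | P i) f i y) x v (\sum_(i | P i) l i).
Proof.
move=> dfl; elim: (index_enum I) => [|i s IH].
  by apply: (dd_eq (dd_cst 0 x v)) => [y|]; rewrite big_nil.
case Pi : (P i); last first.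
  by apply: (dd_eq IH) => [y|]; rewrite big_cons Pi.
by apply: (dd_eq (dd_add (dfl i) IH)) => [y|]; rewrite big_cons Pi.
Qed.

Lemma dd_linear {R : realType} {V W : normedModType R} (L : V -> W) (x v : V) :
  linear L -> continuous L -> dd L x v (L v).
Proof.
move=> linL cL.
pose aM := GRing.isLinear.Build _ _ _ _ _ linL.
pose aL : {linear V -> W} := HB.pack L aM.
have dL : differentiable (aL : V -> W) x by exact: linear_differentiable.
by split => //; rewrite deriveE// (diff_lin (f := aL) x cL).
Qed.

Lemma dd_comp {R : realType} {U V W : normedModType R} {f : U -> V}
    {g : V -> W} {x v : U} {l : V} {m : W} :
  dd f x v l -> dd g (f x) l m -> dd (fun y => g (f y)) x v m.
Proof.
move=> [df dfl] [dg <-]; split; first exact: differentiable_comp.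
rewrite !deriveE//; last exact: differentiable_comp.
by rewrite diff_comp//= -dfl deriveE.
Qed.

Lemma dd_pair {R : realType} {U V W : normedModType R} {f : U -> V}
    {g : U -> W} {x v : U} {l : V} {m : W} :
  dd f x v l -> dd g x v m -> dd (fun y => (f y, g y)) x v (l, m).
Proof.
move=> [df <-] [dg <-]; split; first exact: differentiable_pair.
by rewrite !deriveE//; [rewrite diff_pair|exact: differentiable_pair].
Qed.

Lemma dd_scale {R : realType} {V W : normedModType R} {phi : V -> R^o}
    {f : V -> W} {x v : V} {a : R} {l : W} :
  dd phi x v a -> dd f x v l ->
  dd (fun y => phi y *: f y) x v (a *: f x + phi x *: l).
Proof.
move=> dphi df.
have bil : bilinear_for (GRing.Scale.Law.clone _ _ *:%R _)
    (GRing.Scale.Law.clone _ _ *:%R _) (fun (a : R^o) (w : W) => a *: w).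
  split=> [u'|u] b y z /=; first by rewrite scalerDl scalerA.
  by rewrite scalerDr !scalerA mulrC.
pose bM := bilinear_isBilinear.Build R R^o W W _ _ _ bil.
pose bL : {bilinear R^o -> W -> W} := HB.pack (fun (a : R^o) (w : W) => a *: w) bM.
have cL : continuous (fun p : R^o * W => bL p.1 p.2).
  by move=> p; exact: scale_continuous.
have dL := differentiable_bilin (phi x, f x) cL.
apply: (dd_comp (dd_pair dphi df) (m := a *: f x + phi x *: l)
  (g := fun p : R^o * W => bL p.1 p.2)).
split => //; rewrite deriveE// diff_bilin//=.
by rewrite addrC.
Qed.

Lemma dd_mul {R : realType} {V : normedModType R} {f g : V -> R^o} {x v : V}
    {a b : R} : dd f x v a -> dd g x v b ->
  dd (fun y => f y * g y : R^o) x v (a * g x + f x * b).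
Proof. exact: dd_scale. Qed.

Lemma dd_real {R : realType} (h : R -> R) (t a dh : R) :
  is_derive t 1 h dh -> dd (h : R^o -> R^o) t a (a * dh).
Proof.
move=> dh1.
have df : differentiable (h : R -> R) t by apply/derivable1_diffP.
split => //; rewrite deriveE//.
have -> : 'd (h : R^o -> R^o) t a = a *: 'd (h : R^o -> R^o) t 1.
  by rewrite -linearZ /= /GRing.scale /= mulr1.
by rewrite -deriveE// derive_val.
Qed.

Lemma dd_compR {R : realType} {V : normedModType R} {h : R -> R} {f : V -> R^o}
    {x v : V} {a dh : R} : dd f x v a -> is_derive (f x) 1 h dh ->
  dd (fun y => h (f y) : R^o) x v (a * dh).
Proof. by move=> fd hd; apply: (dd_comp fd); exact: dd_real. Qed.

Lemma continuous_entry {R : realType} {m : nat} (i : 'I_m.+1) :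
  continuous (fun Q : pt R m => Q 0 i : R^o).
Proof. exact: coord_continuous. Qed.

Lemma linear_entry {R : realType} {m : nat} (i : 'I_m.+1) :
  linear (fun Q : pt R m => Q 0 i : R^o).
Proof. by move=> a Q P; rewrite !mxE. Qed.

Lemma dd_entry {R : realType} {V : normedModType R} {m : nat} {f : V -> pt R m}
    {x v : V} {l : pt R m} (i : 'I_m.+1) :
  dd f x v l -> dd (fun y => f y 0 i : R^o) x v (l 0 i).
Proof.
move=> fd; apply: (dd_comp (g := fun Q : pt R m => Q 0 i : R^o) fd).
by apply: dd_linear; [exact: linear_entry|exact: continuous_entry].
Qed.

Lemma dd_fst {R : realType} {V W Z : normedModType R} {f : V -> (W * Z)%type}
    {x v : V} {l : W * Z} : dd f x v l -> dd (fun y => (f y).1) x v l.1.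
Proof.
move=> fd; apply: (dd_comp (g := fst) fd).
by apply: dd_linear => [a p q|p]; [|exact: cvg_fst].
Qed.

Lemma dd_snd {R : realType} {V W Z : normedModType R} {f : V -> (W * Z)%type}
    {x v : V} {l : W * Z} : dd f x v l -> dd (fun y => (f y).2) x v l.2.
Proof.
move=> fd; apply: (dd_comp (g := snd) fd).
by apply: dd_linear => [a p q|p]; [|exact: cvg_snd].
Qed.

Lemma dd_id {R : realType} {V : normedModType R} (x v : V) :
  dd (fun y => y) x v v.
Proof. by apply: dd_linear => // p; exact: cvg_id. Qed.

(** * Closure properties of C^k maps *)

Lemma CkW {R : realType} {V W : normedModType R} {k : nat} {f : V -> W} :
  Ck k.+1 f -> Ck k f.
Proof.
elim: k f => [|k IH] f [df Df]; last by split => // v; exact: IH.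
by move=> x; exact: differentiable_continuous.
Qed.

(** The derivative is supplied as an explicit formula, so that inductions on [k] run on formulas
    already known to be C^k. *)
Lemma CkS {R : realType} {V W : normedModType R} {k : nat} {f : V -> W}
    (df : V -> V -> W) :
  (forall x v, dd f x v (df v x)) -> (forall v, Ck k (df v)) -> Ck k.+1 f.
Proof.
move=> fd Cdf; split=> [x|v]; first by have [] := fd x 0.
suff -> : (fun x => 'D_v f x) = df v by [].
by apply/funext => x; have [] := fd x v.
Qed.

Lemma Ck_cst {R : realType} {V W : normedModType R} (k : nat) (w : W) :
  Ck k (fun _ : V => w).
Proof.
elim: k w => [|k IH] w; first by move=> x; exact: cvg_cst.
by apply: (CkS (fun _ _ => 0)) => // x v; exact: dd_cst.
Qed.

Lemma Ck_linear {R : realType} {V W : normedModType R} (k : nat) (L : V -> W) :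
  linear L -> continuous L -> Ck k L.
Proof.
case: k => [//|k] linL cL; apply: (CkS (fun v _ => L v)) => [x v|v].
  exact: dd_linear.
exact: Ck_cst.
Qed.

Lemma Ck_add {R : realType} {V W : normedModType R} {k : nat} {f g : V -> W} :
  Ck k f -> Ck k g -> Ck k (fun x => f x + g x).
Proof.
elim: k f g => [|k IH] f g.
  by move=> cf cg x; apply: cvgD; [exact: cf|exact: cg].
move=> [df Df] [dg Dg]; apply: (CkS (fun v x => 'D_v f x + 'D_v g x)) => [x v|v].
  by apply: dd_add; exact: dd_diff.
by apply: IH; [exact: Df|exact: Dg].
Qed.

Lemma Ck_scale {R : realType} {V W : normedModType R} {k : nat}
    {phi : V -> R^o} {f : V -> W} :
  Ck k phi -> Ck k f -> Ck k (fun x => phi x *: f x).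
Proof.
elim: k phi f => [|k IH] phi f.
  by move=> cf cg x; apply: cvgZ; [exact: cf|exact: cg].
move=> Cphi Cf; have [[dphi Dphi] [df Df]] := (Cphi, Cf).
apply: (CkS (fun v x => 'D_v phi x *: f x + phi x *: 'D_v f x)) => [x v|v].
  by apply: dd_scale; exact: dd_diff.
apply: Ck_add; apply: IH; [exact: Dphi|exact: CkW|exact: CkW|exact: Df].
Qed.

Lemma Ck_expR {R : realType} {V : normedModType R} {k : nat} {f : V -> R^o} :
  Ck k f -> Ck k (fun x => expR (f x) : R^o).
Proof.
elim: k f => [|k IH] f.
  by move=> cf x; apply: continuous_comp; [exact: cf|exact: continuous_expR].
move=> Cf; have [df Df] := Cf.
apply: (CkS (fun v x => 'D_v f x * expR (f x) : R^o)) => [x v|v].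
  by apply: dd_compR; exact: dd_diff.
by apply: (Ck_scale (phi := fun x => 'D_v f x)); [exact: Df|exact/IH/CkW].
Qed.

(** Each of the two functions is the derivative of the other up to sign, so one induction must carry
    both. *)
Lemma Ck_cos_sin {R : realType} {V : normedModType R} {k : nat} {f : V -> R^o} :
  Ck k f -> Ck k (fun x => cos (f x) : R^o) /\ Ck k (fun x => sin (f x) : R^o).
Proof.
elim: k f => [|k IH] f.
  move=> cf; split=> x; apply: continuous_comp; do 1?exact: cf.
    exact: continuous_cos.
  exact: continuous_sin.
move=> Cf; have [df Df] := Cf; have [Cc Cs] := IH _ (CkW Cf).
split.
  apply: (CkS (fun v x => (- 1 * 'D_v f x) * sin (f x) : R^o)) => [x v|v].
    have -> : - 1 * 'D_v f x * sin (f x) = 'D_v f x * (- sin (f x)) by ring.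
    by apply: dd_compR; exact: dd_diff.
  apply: (Ck_scale (phi := fun x => - 1 * 'D_v f x)) => //.
  by apply: (Ck_scale (phi := fun=> - 1)); [exact: Ck_cst|exact: Df].
apply: (CkS (fun v x => 'D_v f x * cos (f x) : R^o)) => [x v|v].
  by apply: dd_compR; exact: dd_diff.
by apply: (Ck_scale (phi := fun x => 'D_v f x)); [exact: Df|].
Qed.

(** * The horospherical metric and its Sasaki metric *)

Definition vdot {R : realType} {n : nat} (x y : pt R n) : R :=
  \sum_(j < n.+1 | j != 0) x 0 j * y 0 j.

Lemma vdotC {R : realType} {n : nat} (x y : pt R n) : vdot x y = vdot y x.
Proof. by apply: eq_bigr => j _; rewrite mulrC. Qed.

Lemma vdotDl {R : realType} {n : nat} (x y z : pt R n) :
  vdot (x + y) z = vdot x z + vdot y z.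
Proof. by rewrite -big_split; apply: eq_bigr => j _ /=; rewrite mxE mulrDl. Qed.

Lemma vdotZl {R : realType} {n : nat} (a : R) (x z : pt R n) :
  vdot (a *: x) z = a * vdot x z.
Proof. by rewrite big_distrr; apply: eq_bigr => j _ /=; rewrite mxE mulrA. Qed.

Lemma vdotDr {R : realType} {n : nat} (x y z : pt R n) :
  vdot z (x + y) = vdot z x + vdot z y.
Proof. by rewrite vdotC vdotDl !(vdotC z). Qed.

Lemma vdotZr {R : realType} {n : nat} (a : R) (x z : pt R n) :
  vdot z (a *: x) = a * vdot z x.
Proof. by rewrite vdotC vdotZl vdotC. Qed.

Section HoroMetric.
Context {R : realType} {n : nat}.
Local Notation g := (horo_metric R n).
Local Notation w Q := (expR (2 * Q 0 0)).
Implicit Types (Q x y z : pt R n).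

Lemma horo_ip Q x y : ip g Q x y = x 0 0 * y 0 0 + w Q * vdot x y.
Proof.
rewrite /ip /horo_metric mul_mx_diag mxE (bigD1 0)//= !mxE eqxx mulr1.
congr (_ + _); rewrite big_distrr; apply: eq_bigr => j j0 /=.
by rewrite !mxE (negbTE j0); ring.
Qed.

Lemma horo_mulVmx Q :
  g Q *m diag_mx (\row_i if i == 0 then 1 else (w Q)^-1) = 1%:M.
Proof.
rewrite mulmx_diag -diag_const_mx; congr diag_mx; apply/rowP => i.
by rewrite !mxE; case: ifP => _; rewrite ?mulr1// divff// gt_eqF ?expR_gt0.
Qed.

Lemma horo_unitmx Q : g Q \in unitmx.
Proof. by have /mulmx1_unit[] := horo_mulVmx Q. Qed.

Lemma horo_invmx Q :
  invmx (g Q) = diag_mx (\row_i if i == 0 then 1 else (w Q)^-1).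
Proof. by rewrite -[RHS](mulKmx (horo_unitmx Q)) horo_mulVmx mulmx1. Qed.

Lemma horo_partial (j l k : 'I_n.+1) Q :
  partial j (fun P => g P l k) Q =
  if (l == k) && (l != 0) && (j == 0) then 2 * w Q else 0.
Proof.
have [->|lk] /= := eqVneq l k; last first.
  rewrite /partial.
  have -> : (fun P => g P l k) = (fun _ : pt R n => 0).
    by apply/funext => P; rewrite /horo_metric !mxE (negbTE lk).
  exact: derive_cst.
have [->|k0] /= := eqVneq k 0.
  rewrite /partial.
  have -> : (fun P => g P 0 0) = (fun _ : pt R n => 1).
    by apply/funext => P; rewrite /horo_metric !mxE.
  exact: derive_cst.
rewrite /partial.
have -> : (fun P => g P k k) = (fun P : pt R n => w P).
  by apply/funext => P; rewrite /horo_metric !mxE eqxx mulr1n (negbTE k0).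
have [_ ->] := dd_compR (dd_mul (dd_cst (2 : R^o) Q (delta_mx 0 j : pt R n))
  (dd_entry 0 (dd_id Q (delta_mx 0 j)))) (is_derive_expR _).
rewrite mxE eqxx /= (eq_sym 0); case: ifP => _ /=; ring.
Qed.

(** The metric is diagonal and depends on u alone: the only nonzero derivatives are those of the
    entries g_ll with l >= 1 along u, equal to 2 e^{2u}. What survives is Gamma^0_{ll} = - e^{2u}
    and Gamma^l_{0l} = Gamma^l_{l0} = 1. *)
Lemma horo_Gam Q x y :
  Gam g Q x y =
  \row_i if i == 0 then - w Q * vdot x y else x 0 0 * y 0 i + x 0 i * y 0 0.
Proof.
pose d (l : 'I_n.+1) : R := if l == 0 then 0 else 2 * w Q.
have dE (j l k : 'I_n.+1) : partial j (fun P => g P l k) Q =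
    d l * (l == k)%:R * (j == 0)%:R.
  by rewrite horo_partial /d; do 3!case: eqVneq => //= _; ring.
have chE (i j k : 'I_n.+1) : christoffel g Q i j k =
    2^-1 * invmx (g Q) i i * (d i * (i == k)%:R * (j == 0)%:R
      + d j * (j == i)%:R * (k == 0)%:R - d j * (j == k)%:R * (i == 0)%:R).
  rewrite /christoffel -mulrA; congr (_ * _).
  rewrite (bigD1 i)//= big1 ?addr0; first by rewrite !dE.
  by move=> l; rewrite eq_sym => /negbTE il; rewrite horo_invmx !mxE il mulr0n mul0r.
apply/rowP => i; rewrite !mxE.
have sum1 (f : 'I_n.+1 -> R) (k : 'I_n.+1) : \sum_j f j * (j == k)%:R = f k.
  rewrite (bigD1 k)//= eqxx mulr1 big1 ?addr0// => j /negbTE ->.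
  by rewrite mulr0.
transitivity (2^-1 * invmx (g Q) i i *
   (d i * x 0 0 * y 0 i + d i * x 0 i * y 0 0
    - (i == 0)%:R * \sum_j d j * x 0 j * y 0 j)).
  have inner j : \sum_k christoffel g Q i j k * x 0 j * y 0 k =
     2^-1 * invmx (g Q) i i * (d i * x 0 j * y 0 i * (j == 0)%:R
      + d j * x 0 j * y 0 0 * (j == i)%:R - (i == 0)%:R * (d j * x 0 j * y 0 j)).
    (* Each of the three closed terms is reopened as a sum over [k] against a Kronecker delta, so
       that the two sides can be compared term by term. *)
    rewrite -(sum1 (fun k => d i * x 0 j * y 0 k * (j == 0)%:R) i).
    rewrite -(sum1 (fun k => d j * x 0 j * y 0 k * (j == i)%:R) 0).
    rewrite -(sum1 (fun k => (i == 0)%:R * (d j * x 0 j * y 0 k)) j).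
    rewrite -big_split/= -sumrB big_distrr; apply: eq_bigr => k _ /=.
    by rewrite chE (eq_sym i k) (eq_sym j k); ring.
  rewrite (eq_bigr _ (fun j _ => inner j)) -big_distrr /=; congr (_ * _).
  by rewrite sumrB big_split/= -big_distrr/= !sum1.
rewrite horo_invmx !mxE eqxx mulr1n /d.
have w0 : w Q != 0 by rewrite gt_eqF ?expR_gt0.
have [->|i0] /= := eqVneq i 0; last by field.
rewrite (bigD1 0)//= (eq_bigr (fun j => 2 * w Q * (x 0 j * y 0 j))); last first.
  by move=> j /negbTE ->; ring.
by rewrite -big_distrr -/(vdot x y) /=; field.
Qed.

Lemma horo_Gam0 Q x y : Gam g Q x y 0 0 = - w Q * vdot x y.
Proof. by rewrite horo_Gam mxE eqxx. Qed.

Lemma horo_Gam_neq0 Q x y (i : 'I_n.+1) : i != 0 ->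
  Gam g Q x y 0 i = x 0 0 * y 0 i + x 0 i * y 0 0.
Proof. by move=> i0; rewrite horo_Gam mxE (negbTE i0). Qed.

Lemma horo_GamDr Q x y z : Gam g Q x (y + z) = Gam g Q x y + Gam g Q x z.
Proof.
by apply/rowP => i; rewrite !horo_Gam !mxE vdotDr; case: ifP => _; ring.
Qed.

Lemma horo_GamZr Q x y (a : R) : Gam g Q x (a *: y) = a *: Gam g Q x y.
Proof.
by apply/rowP => i; rewrite !horo_Gam !mxE vdotZr; case: ifP => _; ring.
Qed.

Lemma horo_ipC Q x y : ip g Q x y = ip g Q y x.
Proof. by rewrite !horo_ip vdotC mulrC. Qed.

Lemma horo_ipDl Q x y z : ip g Q (x + y) z = ip g Q x z + ip g Q y z.
Proof. by rewrite !horo_ip vdotDl mxE; ring. Qed.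

Lemma horo_ipZl Q (a : R) x z : ip g Q (a *: x) z = a * ip g Q x z.
Proof. by rewrite !horo_ip vdotZl mxE; ring. Qed.

Lemma horo_ipDr Q x y z : ip g Q z (x + y) = ip g Q z x + ip g Q z y.
Proof. by rewrite horo_ipC horo_ipDl !(horo_ipC Q z). Qed.

Lemma horo_ipZr Q (a : R) x z : ip g Q z (a *: x) = a * ip g Q z x.
Proof. by rewrite horo_ipC horo_ipZl horo_ipC. Qed.

Implicit Types (p a b c : tpt R n).

Lemma horo_connmapD p a b : connmap g p (a + b) = connmap g p a + connmap g p b.
Proof. by rewrite /connmap /= horo_GamDr addrACA. Qed.

Lemma horo_connmapZ p (t : R) a : connmap g p (t *: a) = t *: connmap g p a.
Proof. by rewrite /connmap /= horo_GamZr scalerDr. Qed.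

Lemma horo_sasakiC p a b : sasaki g p a b = sasaki g p b a.
Proof. by rewrite /sasaki horo_ipC (horo_ipC _ (connmap _ _ _)). Qed.

Lemma horo_sasakiDl p a b c : sasaki g p (a + b) c = sasaki g p a c + sasaki g p b c.
Proof. by rewrite /sasaki horo_connmapD !horo_ipDl /dproj; ring. Qed.

Lemma horo_sasakiZl p (t : R) a c : sasaki g p (t *: a) c = t * sasaki g p a c.
Proof. by rewrite /sasaki horo_connmapZ !horo_ipZl /dproj; ring. Qed.

Lemma horo_sasakiDr p a b c : sasaki g p c (a + b) = sasaki g p c a + sasaki g p c b.
Proof. by rewrite horo_sasakiC horo_sasakiDl !(horo_sasakiC p c). Qed.

Lemma horo_sasakiZr p (t : R) a c : sasaki g p c (t *: a) = t * sasaki g p c a.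
Proof. by rewrite horo_sasakiC horo_sasakiZl horo_sasakiC. Qed.

Lemma horo_sasakiBl p a b c : sasaki g p (a - b) c = sasaki g p a c - sasaki g p b c.
Proof. by rewrite horo_sasakiDl -scaleN1r horo_sasakiZl mulN1r. Qed.

(** * Derivatives of the metric, of its Christoffel symbols and of the Sasaki metric *)

Section Derivatives.
Context {V : normedModType R}.
Variables (t v : V).

Lemma dd_row {m : nat} (f : V -> pt R m) (l : pt R m) :
  (forall i, dd (fun s => f s 0 i : R^o) t v (l 0 i)) -> dd f t v l.
Proof.
move=> fl.
apply: (dd_eq (dd_sum (P := xpredT)
  (fun i => dd_scale (fl i) (dd_cst (delta_mx 0 i : pt R m) t v)))).
  by move=> s; rewrite [RHS]row_sum_delta.
rewrite [RHS]row_sum_delta; apply: eq_bigr => i _.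
by rewrite scaler0 addr0.
Qed.

Lemma dd_vdot (X Y : V -> pt R n) X' Y' :
  dd X t v X' -> dd Y t v Y' ->
  dd (fun s => vdot (X s) (Y s) : R^o) t v (vdot X' (Y t) + vdot (X t) Y').
Proof.
move=> dX dY; rewrite -big_split.
by apply: (dd_sum (f := fun i s => X s 0 i * Y s 0 i : R^o)) => i;
  apply: dd_mul; exact: dd_entry.
Qed.

Lemma dd_weight (P : V -> pt R n) P' :
  dd P t v P' -> dd (fun s => w (P s) : R^o) t v (2 * P' 0 0 * w (P t)).
Proof.
move=> dP; apply: (dd_eq (dd_compR (dd_mul (dd_cst (2 : R^o) t v)
  (dd_entry 0 dP)) (is_derive_expR _))) => //.
by rewrite mul0r add0r.
Qed.

Variables (P X Y : V -> pt R n) (P' X' Y' : pt R n).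
Hypotheses (dP : dd P t v P') (dX : dd X t v X') (dY : dd Y t v Y').

Lemma dd_horo_ip :
  dd (fun s => ip g (P s) (X s) (Y s) : R^o) t v
   (2 * P' 0 0 * w (P t) * vdot (X t) (Y t)
    + ip g (P t) X' (Y t) + ip g (P t) (X t) Y').
Proof.
apply: (dd_eq (dd_add (dd_mul (dd_entry 0 dX) (dd_entry 0 dY))
   (dd_mul (dd_weight _ _ dP) (dd_vdot _ _ _ _ dX dY)))) => [s|].
  by rewrite horo_ip.
by rewrite !horo_ip; ring.
Qed.

(** The base point enters [Gam] only through the weight e^{2u} of the component of index 0; hence
    the single term along [delta_mx 0 0]. *)
Lemma dd_horo_Gam :
  dd (fun s => Gam g (P s) (X s) (Y s)) t v
   ((- (2 * P' 0 0 * w (P t) * vdot (X t) (Y t))) *: delta_mx 0 0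
    + Gam g (P t) X' (Y t) + Gam g (P t) (X t) Y').
Proof.
apply: dd_row => i; have [->|i0] := eqVneq i 0.
  apply: (dd_eq (dd_mul (dd_cst (-1 : R^o) t v)
    (dd_mul (dd_weight _ _ dP) (dd_vdot _ _ _ _ dX dY)))) => [s|].
    by rewrite horo_Gam0; ring.
  by rewrite mxE [in RHS]mxE !horo_Gam0 !mxE eqxx /=; ring.
apply: (dd_eq (dd_add (dd_mul (dd_entry 0 dX) (dd_entry i dY))
   (dd_mul (dd_entry i dX) (dd_entry 0 dY)))) => [s|].
  by rewrite horo_Gam_neq0.
rewrite mxE [in RHS]mxE !horo_Gam_neq0// !mxE (negbTE i0) /=; ring.
Qed.

End Derivatives.

(* The derivative in the direction a, at p, of connmap applied to a constant b. *)
Definition dconnmap p a b : pt R n :=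
  (- (2 * a.1 0 0 * w p.1 * vdot p.2 b.1)) *: delta_mx 0 0 + Gam g p.1 a.2 b.1.

(** The derivative along [a] of the Sasaki product of the constant vectors [b] and [c]: the weight
    varies in both inner products, and the connection map varies by [dconnmap]. *)
Definition dsasaki p a b c : R :=
  2 * a.1 0 0 * w p.1 * (vdot b.1 c.1 + vdot (connmap g p b) (connmap g p c))
  + ip g p.1 (dconnmap p a b) (connmap g p c)
  + ip g p.1 (connmap g p b) (dconnmap p a c).

Lemma dd_connmap (Y : tpt R n -> tpt R n) p a Y' :
  dd Y p a Y' ->
  dd (fun q => connmap g q (Y q)) p a (dconnmap p a (Y p) + connmap g p Y').
Proof.
move=> dY.
apply: (dd_eq (dd_add (dd_snd dY) (dd_horo_Gam _ _ _ _ _ _ _ _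
  (dd_fst (dd_id p a)) (dd_snd (dd_id p a)) (dd_fst dY)))) => //.
by rewrite /dconnmap /connmap addrCA addrA.
Qed.

Lemma dd_sasaki (Y Z : tpt R n -> tpt R n) p a Y' Z' :
  dd Y p a Y' -> dd Z p a Z' ->
  dd (fun q => sasaki g q (Y q) (Z q) : R^o) p a
    (dsasaki p a (Y p) (Z p) + sasaki g p Y' (Z p) + sasaki g p (Y p) Z').
Proof.
move=> dY dZ.
apply: (dd_eq (dd_add
  (dd_horo_ip _ _ _ _ _ _ _ _ (dd_fst (dd_id p a)) (dd_fst dY) (dd_fst dZ))
  (dd_horo_ip _ _ _ _ _ _ _ _ (dd_fst (dd_id p a)) (dd_connmap _ _ _ _ dY)
    (dd_connmap _ _ _ _ dZ)))) => //=.
by rewrite /sasaki /dsasaki /dproj !horo_ipDl !horo_ipDr; ring.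
Qed.

(** This is the compatibility of the Levi-Civita connection with the metric: the length of the fibre
    vector is constant along horizontal directions. *)
Lemma dd_sqnorm p a :
  dd (sqnorm g) p a (2 * ip g p.1 (connmap g p a) p.2).
Proof.
apply: (dd_eq (dd_horo_ip _ _ _ _ _ _ _ _ (dd_fst (dd_id p a))
  (dd_snd (dd_id p a)) (dd_snd (dd_id p a)))) => //=.
rewrite /connmap horo_ipDl (horo_ipC _ p.2) (horo_ip _ (Gam _ _ _ _)).
rewrite horo_Gam0.
suff -> : vdot (Gam g p.1 p.2 a.1) p.2 =
    p.2 0 0 * vdot p.2 a.1 + a.1 0 0 * vdot p.2 p.2 by ring.
rewrite /vdot !big_distrr -big_split; apply: eq_bigr => i i0 /=.
by rewrite horo_Gam_neq0//; ring.
Qed.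

Lemma tangent_T1E p a : tangent_T1 g p a <-> ip g p.1 (connmap g p a) p.2 = 0.
Proof.
rewrite /tangent_T1; have [_ ->] := dd_sqnorm p a; split=> [|->].
  by move/eqP; rewrite mulf_eq0 pnatr_eq0 /= => /eqP.
by rewrite mulr0.
Qed.

End HoroMetric.

(** * C^k maps into products and row vectors *)

Lemma Ck_linear_comp {R : realType} {V W Z : normedModType R} {k : nat}
    (L : W -> Z) {f : V -> W} :
  linear L -> continuous L -> Ck k f -> Ck k (fun x => L (f x)).
Proof.
move=> linL cL; elim: k f => [|k IH] f.
  by move=> cf x; apply: continuous_comp; [exact: cf|exact: cL].
move=> [df Df]; apply: (CkS (fun v x => L ('D_v f x))) => [x v|v].
  by apply: dd_comp; [exact: dd_diff|exact: dd_linear].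
by apply: IH; exact: Df.
Qed.

Lemma Ck_entry {R : realType} {V : normedModType R} {m k : nat}
    {f : V -> pt R m} (i : 'I_m.+1) : Ck k f -> Ck k (fun x => f x 0 i : R^o).
Proof.
apply: (Ck_linear_comp (fun Q : pt R m => Q 0 i : R^o)).
  exact: linear_entry.
exact: continuous_entry.
Qed.

Lemma Ck_fst {R : realType} {V W Z : normedModType R} {k : nat}
    {f : V -> (W * Z)%type} : Ck k f -> Ck k (fun x => (f x).1).
Proof. by apply: (Ck_linear_comp fst) => [a p q|p]; [|exact: cvg_fst]. Qed.

Lemma Ck_snd {R : realType} {V W Z : normedModType R} {k : nat}
    {f : V -> (W * Z)%type} : Ck k f -> Ck k (fun x => (f x).2).
Proof. by apply: (Ck_linear_comp snd) => [a p q|p]; [|exact: cvg_snd]. Qed.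

Lemma Ck_pair {R : realType} {V W Z : normedModType R} {k : nat}
    {f : V -> W} {h : V -> Z} : Ck k f -> Ck k h -> Ck k (fun x => (f x, h x)).
Proof.
elim: k f h => [|k IH] f h.
  by move=> cf ch x; apply: cvg_pair; [exact: cf|exact: ch].
move=> [df Df] [dh Dh].
apply: (CkS (fun v x => ('D_v f x, 'D_v h x))) => [x v|v].
  by apply: dd_pair; exact: dd_diff.
by apply: IH; [exact: Df|exact: Dh].
Qed.

Lemma Ck_id {R : realType} {V : normedModType R} (k : nat) :
  Ck k (fun x : V => x).
Proof. by apply: Ck_linear => // x; exact: cvg_id. Qed.

Lemma Ck_mul {R : realType} {V : normedModType R} {k : nat} {f h : V -> R^o} :
  Ck k f -> Ck k h -> Ck k (fun x => f x * h x : R^o).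
Proof. exact: Ck_scale. Qed.

Lemma Ck_sum {R : realType} {V W : normedModType R} {I : finType}
    {P : pred I} {k : nat} {f : I -> V -> W} :
  (forall i, Ck k (f i)) -> Ck k (fun x => \sum_(i | P i) f i x).
Proof.
move=> Cf; elim: (index_enum I) => [|i s IH].
  rewrite (_ : (fun _ => _) = (fun=> 0)); first exact: Ck_cst.
  by apply/funext => x; rewrite big_nil.
case Pi : (P i).
  rewrite (_ : (fun _ => _) = (fun x => f i x + \sum_(j <- s | P j) f j x)).
    exact: Ck_add.
  by apply/funext => x; rewrite big_cons Pi.
rewrite (_ : (fun _ => _) = (fun x => \sum_(j <- s | P j) f j x)) //.
by apply/funext => x; rewrite big_cons Pi.
Qed.

Lemma Ck_row {R : realType} {V : normedModType R} {m k : nat}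
    {f : V -> pt R m} : (forall i, Ck k (fun x => f x 0 i : R^o)) -> Ck k f.
Proof.
move=> Cf.
rewrite (_ : f = (fun x => \sum_i f x 0 i *: (delta_mx 0 i : pt R m))); last first.
  by apply/funext => x; rewrite [LHS]row_sum_delta.
by apply: Ck_sum => i; apply: Ck_scale => //; exact: Ck_cst.
Qed.

(** * The second fundamental form of a unit vector field *)

Section HoroConnection.
Context {R : realType} {n : nat}.
Local Notation g := (horo_metric R n).
Local Notation w Q := (expR (2 * Q 0 0)).
Implicit Types (Q x y z : pt R n) (p a b c : tpt R n).

Section Smooth.
Context {V : normedModType R} {k : nat}.
Implicit Types P X Y : V -> pt R n.

Lemma Ck_vdot X Y : Ck k X -> Ck k Y -> Ck k (fun s => vdot (X s) (Y s) : R^o).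
Proof.
move=> CX CY; apply: (Ck_sum (f := fun i s => X s 0 i * Y s 0 i : R^o)) => i.
by apply: Ck_mul; exact: Ck_entry.
Qed.

Lemma Ck_weight P : Ck k P -> Ck k (fun s => w (P s) : R^o).
Proof.
by move=> CP; apply: Ck_expR; apply: Ck_mul; [exact: Ck_cst|exact: Ck_entry].
Qed.

Lemma Ck_horo_ip P X Y : Ck k P -> Ck k X -> Ck k Y ->
  Ck k (fun s => ip g (P s) (X s) (Y s) : R^o).
Proof.
move=> CP CX CY.
rewrite (_ : (fun _ => _) = (fun s =>
  X s 0 0 * Y s 0 0 + w (P s) * vdot (X s) (Y s) : R^o)).
  apply: Ck_add; apply: Ck_mul; do ?exact: Ck_entry.
    exact: Ck_weight.
  exact: Ck_vdot.
by apply/funext => s; rewrite horo_ip.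
Qed.

Lemma Ck_horo_Gam P X Y : Ck k P -> Ck k X -> Ck k Y ->
  Ck k (fun s => Gam g (P s) (X s) (Y s)).
Proof.
move=> CP CX CY; apply: Ck_row => i; have [->|i0] := eqVneq i 0.
  rewrite (_ : (fun _ => _) = (fun s =>
    -1 * (w (P s) * vdot (X s) (Y s)) : R^o)).
    apply: Ck_mul; first exact: Ck_cst.
    by apply: Ck_mul; [exact: Ck_weight|exact: Ck_vdot].
  by apply/funext => s; rewrite horo_Gam0; ring.
rewrite (_ : (fun _ => _) = (fun s =>
  X s 0 0 * Y s 0 i + X s 0 i * Y s 0 0 : R^o)).
  by apply: Ck_add; apply: Ck_mul; exact: Ck_entry.
by apply/funext => s; rewrite horo_Gam_neq0.
Qed.

End Smooth.

(* Every tangent vector of T_1 M extends to a field on T_1 M: remove from the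
   constant field its component along the vertical position vector (0, z). *)
Lemma tangent_extension p a : tangent_T1 g p a ->
  exists Z, field_T1 g Z /\ Z p = a.
Proof.
move=> /tangent_T1E ta.
exists (fun q => a + (- ip g q.1 (connmap g q a) q.2) *: ((0, q.2) : tpt R n)).
split; last by rewrite ta oppr0 scale0r addr0.
split=> [k|q q1].
  have C1 : Ck k (fun q : tpt R n => q.1) by exact/Ck_fst/Ck_id.
  have C2 : Ck k (fun q : tpt R n => q.2) by exact/Ck_snd/Ck_id.
  apply: Ck_add; first exact: Ck_cst.
  apply: Ck_scale; last by apply: Ck_pair => //; exact: Ck_cst.
  rewrite (_ : (fun _ => _) = (fun q : tpt R n =>
    -1 * ip g q.1 (connmap g q a) q.2 : R^o)).
    apply: Ck_mul; first exact: Ck_cst.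
    apply: Ck_horo_ip => //; apply: Ck_add; first exact: Ck_cst.
    by apply: Ck_horo_Gam => //; exact: Ck_cst.
  by apply/funext => q; rewrite mulN1r.
apply/tangent_T1E; rewrite horo_connmapD horo_connmapZ.
rewrite -[(0, q.2)]/(vlift g q q.2) connmap_vlift horo_ipDl horo_ipZl.
by rewrite -[ip g q.1 q.2 q.2]/(sqnorm g q) q1 mulr1 subrr.
Qed.

Lemma dconnmap_linearl p b : linear (dconnmap p ^~ b).
Proof.
move=> t a c; apply/rowP => i; rewrite /dconnmap !horo_Gam !mxE vdotDl vdotZl.
by case: ifP => _ /=; ring.
Qed.

Lemma dconnmap_linearr p a : linear (dconnmap p a).
Proof.
move=> t b c; apply/rowP => i; rewrite /dconnmap !horo_Gam !mxE !vdotDr !vdotZr.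
by case: ifP => _ /=; ring.
Qed.

Lemma dsasakiC p a b c : dsasaki p a b c = dsasaki p a c b.
Proof.
rewrite /dsasaki (vdotC c.1) (vdotC (connmap g p c)).
by rewrite (horo_ipC _ (connmap g p c)) (horo_ipC _ _ (connmap g p b)); ring.
Qed.

Lemma dsasaki_linear1 p (t : R) a a' b c :
  dsasaki p (t *: a + a') b c = t * dsasaki p a b c + dsasaki p a' b c.
Proof.
rewrite /dsasaki !dconnmap_linearl.
by rewrite !(horo_ipDl, horo_ipZl, horo_ipDr, horo_ipZr) !mxE; ring.
Qed.

Lemma dsasaki_linear2 p a (t : R) b b' c :
  dsasaki p a (t *: b + b') c = t * dsasaki p a b c + dsasaki p a b' c.
Proof.
rewrite /dsasaki !dconnmap_linearr horo_connmapD horo_connmapZ.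
by rewrite !(horo_ipDl, horo_ipZl, vdotDl, vdotZl); ring.
Qed.

(* The Christoffel symbols of the first kind of the Sasaki metric. *)
Definition christoffel_form p a b c : R :=
  2^-1 * (dsasaki p a b c + dsasaki p b a c - dsasaki p c a b).

Lemma christoffel_formE p a b c : christoffel_form p a b c =
  2^-1 * (dsasaki p a b c + dsasaki p b a c - dsasaki p c a b).
Proof. by []. Qed.

Lemma christoffel_formC p a b c :
  christoffel_form p a b c = christoffel_form p b a c.
Proof.
rewrite /christoffel_form (dsasakiC p c).
by congr (_ * (_ - _)); rewrite addrC.
Qed.

Lemma christoffel_form_linear p (t : R) a a' b c :
  christoffel_form p (t *: a + a') b c =
  t * christoffel_form p a b c + christoffel_form p a' b c.
Proof.
rewrite /christoffel_form dsasaki_linear1 !dsasaki_linear2.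
have arith (d1 d2 d3 e1 e2 e3 : R) :
  2^-1 * (t * d1 + e1 + (t * d2 + e2) - (t * d3 + e3))
  = t * (2^-1 * (d1 + d2 - d3)) + 2^-1 * (e1 + e2 - e3) by ring.
exact: arith.
Qed.

Variable D : (tpt R n -> tpt R n) -> (tpt R n -> tpt R n) -> tpt R n -> tpt R n.
Hypothesis lcD : levi_civita_T1 g D.

(* The Koszul formula, with the derivatives of the fields other than that of Y
   along X cancelled. *)
Lemma koszul X Y Z p : field_T1 g X -> field_T1 g Y -> field_T1 g Z -> T1 g p ->
  sasaki g p (D X Y p) (Z p) =
  sasaki g p ('D_(X p) Y p) (Z p) + christoffel_form p (X p) (Y p) (Z p).
Proof.
move=> fX fY fZ p1.
have dd_field U : field_T1 g U -> forall a, dd U p a ('D_a U p).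
  by move=> fU a; apply: dd_diff; have [/(_ 1%N)[]] := fU.
have product U V A : field_T1 g A -> field_T1 g U -> field_T1 g V ->
    dsasaki p (A p) (U p) (V p) + sasaki g p ('D_(A p) U p) (V p)
     + sasaki g p (U p) ('D_(A p) V p) =
    sasaki g p (D A U p) (V p) + sasaki g p (U p) (D A V p).
  move=> fA fU fV; rewrite -(lc_metric lcD)//.
  by have [_ ->] := dd_sasaki _ _ _ _ _ _ (dd_field _ fU (A p)) (dd_field _ fV (A p)).
have torsion U V c : field_T1 g U -> field_T1 g V ->
    sasaki g p (D U V p) c - sasaki g p (D V U p) c =
    sasaki g p ('D_(U p) V p) c - sasaki g p ('D_(V p) U p) c.
  move=> fU fV; rewrite -!horo_sasakiBl.
  by have := lc_torsion lcD fU fV p1; rewrite /bracket => ->.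
have sC := horo_sasakiC p.
rewrite christoffel_formE.
(* The product rules along [X] and [Y] count with a plus sign, the one along [Z] with a minus sign,
   and the torsion identities cancel all but one derivative. Primed variables are pairings with
   exchanged arguments. *)
have arith (dX dY dZ x1 x2 x3 x4 x5 x6 y1 y2 y3 y4 y5 y6
    x2' x4' x6' y2' y4' y6' : R) :
    x2' = x2 -> x4' = x4 -> x6' = x6 -> y2' = y2 -> y4' = y4 -> y6' = y6 ->
    dX + x1 + x2' = y1 + y2' -> dY + x3 + x4' = y3 + y4' ->
    dZ + x5 + x6' = y5 + y6' -> y1 - y3 = x1 - x3 -> y2 - y5 = x2 - x5 ->
    y4 - y6 = x4 - x6 -> y1 = x1 + 2^-1 * (dX + dY - dZ).
  by do 6!move=> ->; lra.
exact: (arith _ _ _ _ _ _ _ _ _ _ _ _ _ _ _ _ _ _ _ _ _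
  (sC (Y p) ('D_(X p) Z p)) (sC (X p) ('D_(Y p) Z p)) (sC (X p) ('D_(Z p) Y p))
  (sC (Y p) (D X Z p)) (sC (X p) (D Y Z p)) (sC (X p) (D Z Y p))
  (product Y Z X fX fY fZ) (product X Z Y fY fX fZ) (product X Y Z fZ fX fY)
  (torsion X Y (Z p) fX fY) (torsion X Z (Y p) fX fZ)
  (torsion Y Z (X p) fY fZ)).
Qed.

(** The coordinates of [xi] depend on u alone; by the hypotheses below, [xi1] and [xi2] are their
    first and second u-derivatives. *)
Variables (xi xi1 xi2 : pt R n -> pt R n).
Hypothesis unit_xi : unit_vector_field g xi.
Hypothesis dd_xi : forall Q y, dd xi Q y (y 0 0 *: xi1 Q).
Hypothesis dd_xi1 : forall Q y, dd xi1 Q y (y 0 0 *: xi2 Q).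

Lemma dd_sect Q y : dd (sect xi) Q y (y, y 0 0 *: xi1 Q).
Proof. by apply: dd_pair; [exact: dd_id|exact: dd_xi]. Qed.

Lemma dsectE Q y : dsect xi Q y = (y, y 0 0 *: xi1 Q).
Proof. by have [] := dd_sect Q y. Qed.

Lemma dsect_linear Q : linear (dsect xi Q).
Proof.
move=> t x y; rewrite !dsectE; congr (_, _).
by rewrite !mxE scalerDl -scalerA.
Qed.

(* The shape operator of xi(M), through the Koszul formula. *)
Definition omega Q (nu : tpt R n) x y : R :=
  x 0 0 * y 0 0 * sasaki g (sect xi Q) (0, xi2 Q) nu
  + christoffel_form (sect xi Q) (dsect xi Q x) (dsect xi Q y) nu.

Lemma Omega_frame F Q nu (i j : 'I_n.+1) : frame_extension g xi F ->
  tangent_T1 g (sect xi Q) nu ->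
  Omega g D (sect xi Q) nu (F i) (F j) = omega Q nu (delta_mx 0 i) (delta_mx 0 j).
Proof.
move=> [fF FE] tnu; have [Z [fZ Znu]] := tangent_extension _ _ tnu.
have p1 : T1 g (sect xi Q) by rewrite /T1 /sqnorm /=; have [_ ->] := unit_xi.
have := koszul _ _ _ _ (fF i) (fF j) fZ p1.
(* The direction [F i] is tangent to xi(M), so the derivative of [F j] only sees its restriction to
   xi(M), and there [F j] is the explicit coordinate frame. *)
have DF : 'D_(F i (sect xi Q)) (F j) (sect xi Q) =
    (((delta_mx 0 i : pt R n) 0 0 * (delta_mx 0 j : pt R n) 0 0)
      *: ((0, xi2 Q) : tpt R n)).
  have dF : differentiable (F j) (sect xi Q) by have [/(_ 1%N)[]] := fF j.
  rewrite FE dsectE.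
  have [_ <-] := dd_comp (dd_sect Q (delta_mx 0 i)) (dd_diff _ _ _ dF).
  have -> : (fun P => F j (sect xi P)) =
      (fun P => (delta_mx 0 j : pt R n, (delta_mx 0 j : pt R n) 0 0 *: xi1 P)).
    by apply/funext => P; rewrite FE dsectE.
  have [_ ->] := dd_pair (dd_cst (delta_mx 0 j : pt R n) Q (delta_mx 0 i))
    (dd_scale (dd_cst ((delta_mx 0 j : pt R n) 0 0 : R^o) Q (delta_mx 0 i))
      (dd_xi1 Q (delta_mx 0 i))).
  rewrite scale0r add0r scalerA mulrC.
  by rewrite [RHS]/GRing.scale /= /scale_pair /= scaler0.
by rewrite DF Znu !FE horo_sasakiZl.
Qed.

Lemma bilinear_expand (phi : pt R n -> pt R n -> R) :
  (forall y, linear (phi^~ y : pt R n -> R^o)) ->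
  (forall x, linear (phi x : pt R n -> R^o)) ->
  forall x y, phi x y = \sum_i \sum_j x 0 i * y 0 j
    * phi (delta_mx 0 i) (delta_mx 0 j).
Proof.
move=> linl linr x y.
have expand (f : pt R n -> R^o) (z : pt R n) : linear f ->
    f z = \sum_i z 0 i * f (delta_mx 0 i).
  move=> linf.
  pose fM := GRing.isLinear.Build _ _ _ _ _ linf.
  pose fL : {linear pt R n -> R^o} := HB.pack f fM.
  rewrite {1}(_ : z = \sum_i z 0 i *: delta_mx 0 i); last exact: row_sum_delta.
  rewrite -[f]/(fL : _ -> _) linear_sum; apply: eq_bigr => i _.
  by rewrite linearZ.
rewrite (expand _ x (linl y)); apply: eq_bigr => i _.
rewrite (expand _ y (linr _)) big_distrr; apply: eq_bigr => j _ /=.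
by rewrite mulrA.
Qed.

Lemma omegaC Q nu x y : omega Q nu x y = omega Q nu y x.
Proof.
rewrite /omega (mulrC (x 0 0)).
by move: (dsect xi Q x) (dsect xi Q y) => X Y; rewrite christoffel_formC.
Qed.

Lemma omega_linear Q nu (t : R) x x' y :
  omega Q nu (t *: x + x') y = t * omega Q nu x y + omega Q nu x' y.
Proof.
rewrite /omega (dsect_linear Q t x x') christoffel_form_linear.
rewrite [X in X * y 0 0 * _]mxE [X in (X + _) * y 0 0 * _]mxE.
have arith (x0 x1 y0 S d1 e1 : R) : (t * x0 + x1) * y0 * S + (t * d1 + e1) =
  t * (x0 * y0 * S + d1) + (x1 * y0 * S + e1) by ring.
exact: arith.
Qed.

(** Let [P] have the vectors [E i] as rows. Orthonormality says P G P^T = 1, so G^{-1} = P^T P, and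
    cyclicity turns tr(G^{-1} Om) into tr(P Om P^T), whose diagonal entries are the values of
    [omega] on the [E i]. *)
Lemma mean_curv_orthonormal F Q nu (E : 'I_n.+1 -> pt R n) :
  frame_extension g xi F -> tangent_T1 g (sect xi Q) nu ->
  (forall i j, sasaki g (sect xi Q) (dsect xi Q (E i)) (dsect xi Q (E j)) =
     (i == j)%:R) ->
  mean_curv g D xi F Q nu = (n.+1%:R)^-1 * \sum_i omega Q nu (E i) (E i).
Proof.
move=> fF tnu onE; rewrite /mean_curv; congr (_ * _).
set G := \matrix_(_, _) _; set Om := \matrix_(_, _) _.
pose P : 'M[R]_n.+1 := \matrix_(i, j) E i 0 j.
have conj (phi : pt R n -> pt R n -> R) (A : 'M[R]_n.+1) :
    (forall y, linear (phi^~ y : pt R n -> R^o)) ->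
    (forall x, linear (phi x : pt R n -> R^o)) ->
    (forall i j, A i j = phi (delta_mx 0 i) (delta_mx 0 j)) ->
    forall i j, (P *m A *m P^T) i j = phi (E i) (E j).
  move=> linl linr AE h l; rewrite (bilinear_expand _ linl linr).
  rewrite mxE exchange_big; apply: eq_bigr => j _.
  rewrite !mxE big_distrl; apply: eq_bigr => i _ /=.
  by rewrite !mxE AE; ring.
have PG : P *m G *m P^T = 1%:M.
  apply/matrixP => h l; rewrite (conj (fun x y =>
    sasaki g (sect xi Q) (dsect xi Q x) (dsect xi Q y))).
  - by rewrite onE mxE.
  - by move=> y t x x'; rewrite dsect_linear horo_sasakiDl horo_sasakiZl.
  - by move=> y t x x'; rewrite dsect_linear horo_sasakiDr horo_sasakiZr.
  - by move=> i j; have [_ FE] := fF; rewrite mxE !FE.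
have GPP : G *m (P^T *m P) = 1%:M.
  by rewrite mulmxA; apply: mulmx1C; rewrite mulmxA.
have uG : G \in unitmx by have /mulmx1_unit[] := GPP.
have -> : invmx G = P^T *m P by rewrite -(mulKmx uG (P^T *m P)) GPP mulmx1.
rewrite -mulmxA mxtrace_mulC; apply: eq_bigr => h _.
apply: (conj (omega Q nu)) => [y|x|i j].
- by move=> t x x'; rewrite omega_linear.
- by move=> t y y'; rewrite !(omegaC _ _ x) omega_linear.
- by rewrite mxE; exact: Omega_frame.
Qed.

End HoroConnection.

(** * The field xi_theta *)

Section MeanCurvature.
Context {R : realType} {n : nat}.
Variables (theta : R) (hn : (2 <= n)%N).
Local Notation g := (horo_metric R n).
Local Notation w Q := (expR (2 * Q 0 0)).
Local Notation c := (cos theta).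
Local Notation s := (sin theta).
Local Notation i1 := (inord 1 : 'I_n.+1).
Local Notation i2 := (inord 2 : 'I_n.+1).
Local Notation e i := (delta_mx 0 i : pt R n).
Implicit Types (Q h k : pt R n).

(** [inord k] has value [k] only for [k <= n]; [hn] is what keeps the indices 0, [i1] and [i2]
    distinct. *)
Lemma i1_neq0 : (i1 == 0) = false.
Proof. by rewrite -val_eqE /= inordK// ltnS (leq_trans _ hn). Qed.

Lemma i2_neq0 : (i2 == 0) = false.
Proof. by rewrite -val_eqE /= inordK. Qed.

Lemma i1_neq_i2 : (i1 == i2) = false.
Proof. by rewrite -val_eqE /= !inordK// ltnS (leq_trans _ hn). Qed.

Lemma i2_neq_i1 : (i2 == i1) = false.
Proof. by rewrite eq_sym i1_neq_i2. Qed.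

Lemma eq0_i1 : (0 == i1) = false. Proof. by rewrite eq_sym i1_neq0. Qed.

Lemma eq0_i2 : (0 == i2) = false. Proof. by rewrite eq_sym i2_neq0. Qed.

Definition idxE :=
  (eqxx, i1_neq0, i2_neq0, i1_neq_i2, i2_neq_i1, eq0_i1, eq0_i2).

(* The vector with coordinates h in the orthonormal frame X_0,
   cos u X_1 + sin u X_2, - sin u X_1 + cos u X_2, X_3, ..., X_n. *)
Definition fr Q h : pt R n :=
  \row_i if i == 0 then h 0 0 else expR (- Q 0 0) *
   (if i == i1 then cos (Q 0 0) * h 0 i1 - sin (Q 0 0) * h 0 i2
    else if i == i2 then sin (Q 0 0) * h 0 i1 + cos (Q 0 0) * h 0 i2
    else h 0 i).

Lemma fr0 Q h : fr Q h 0 0 = h 0 0.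
Proof. by rewrite mxE eqxx. Qed.

Lemma frD Q h k : fr Q (h + k) = fr Q h + fr Q k.
Proof. by apply/rowP => i; rewrite !mxE; do 3?case: ifP => _ //; ring. Qed.

Lemma frZ Q (a : R) h : fr Q (a *: h) = a *: fr Q h.
Proof. by apply/rowP => i; rewrite !mxE; do 3?case: ifP => _ //; ring. Qed.

Lemma fr_e0 Q : fr Q (e 0) = e 0.
Proof.
apply/rowP => i; rewrite !mxE /= !idxE.
by case: ifP => i0 //=; do 2?[case: ifP => _]; rewrite ?i0 /=; ring.
Qed.

Lemma big_coords (f : 'I_n.+1 -> R) : \sum_(j < n.+1 | j != 0) f j =
  f i1 + f i2 + \sum_(j < n.+1 | [&& j != 0, j != i1 & j != i2]) f j.
Proof.
rewrite (bigD1 i1) ?idxE//= (bigD1 i2) ?idxE//= addrA.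
by congr (_ + _); apply: eq_bigl => j; rewrite andbA.
Qed.

(** The square of the factor e^{-u} in X_alpha cancels the weight, and the rotation by the angle u
    preserves the product in the first two v-coordinates. *)
Lemma vdot_fr Q h k : w Q * vdot (fr Q h) (fr Q k) = vdot h k.
Proof.
have wE : w Q * expR (- Q 0 0) ^+ 2 = 1.
  by rewrite -expRM_natl -expRD mulrN subrr expR0.
rewrite /vdot !big_coords !mxE !idxE mulrDr.
congr (_ + _).
  transitivity ((w Q * expR (- Q 0 0) ^+ 2) *
    (cos (Q 0 0) ^+ 2 + sin (Q 0 0) ^+ 2) * (h 0 i1 * k 0 i1 + h 0 i2 * k 0 i2)).
    ring.
  by rewrite wE cos2Dsin2; ring.
rewrite big_distrr; apply: eq_bigr => j /and3P[/negbTE j0 /negbTE j1 /negbTE j2].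
rewrite !mxE j0 j1 j2 /=.
transitivity ((w Q * expR (- Q 0 0) ^+ 2) * (h 0 j * k 0 j)); first ring.
by rewrite wE mul1r.
Qed.

Lemma ip_fr Q h k : ip g Q (fr Q h) (fr Q k) = h 0 0 * k 0 0 + vdot h k.
Proof. by rewrite horo_ip !fr0 vdot_fr. Qed.

(** Without a case distinction on the index, [Gam] is transported by [fr Q] at once: [fr Q] is
    linear, fixes [e 0] and keeps the coordinate of index 0. The term 2 x_0 y_0 corrects the
    component of index 0. *)
Lemma horo_GamE Q (x y : pt R n) : Gam g Q x y =
  x 0 0 *: y + y 0 0 *: x - (w Q * vdot x y + 2 * x 0 0 * y 0 0) *: e 0.
Proof.
apply/rowP => i; rewrite horo_Gam !mxE /=.
by have [->|i0] := eqVneq i 0; rewrite /=; ring.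
Qed.

Definition hGam h k : pt R n :=
  h 0 0 *: k + k 0 0 *: h - (vdot h k + 2 * h 0 0 * k 0 0) *: e 0.

Lemma Gam_fr Q h k : Gam g Q (fr Q h) (fr Q k) = fr Q (hGam h k).
Proof. by rewrite horo_GamE vdot_fr !fr0 !frD -scaleNr !frZ fr_e0 scaleNr. Qed.

(** * The field and the normal directions in the rotating frame *)

Definition hxi : pt R n := c *: e 0 + s *: e i1.
(** The coordinate u-derivatives of E_1 and E_2 are - E_1 + E_2 and - E_2 - E_1: the factor e^{-u}
    gives the first term and the rotation the second. Applied once and twice to sin theta E_1, this
    rule gives [hxi1] and [hxi2]. *)
Definition hxi1 : pt R n := - s *: e i1 + s *: e i2.
Definition hxi2 : pt R n := - (2 * s) *: e i2.

Definition hf (t : nat) : pt R n :=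
  match t with
  | 1 => - s *: e 0 + c *: e i1
  | _ => e (inord t)
  end.

Lemma fr_e Q (i : 'I_n.+1) : i != 0 -> i != i1 -> i != i2 ->
  fr Q (e i) = expR (- Q 0 0) *: e i.
Proof.
move=> i0 j1 j2; apply/rowP => j; rewrite !mxE /= !(eq_sym _ i).
rewrite (negbTE i0) (negbTE j1) (negbTE j2) /=.
have [->|ji] := eqVneq j i.
  by rewrite (negbTE i0) (negbTE j1) (negbTE j2).
by do 3?[case: ifP => _ //=]; ring.
Qed.

Lemma fr_e1 Q : fr Q (e i1) = cos (Q 0 0) *: horoX 1 Q + sin (Q 0 0) *: horoX 2 Q.
Proof.
apply/rowP => j; rewrite !mxE /= !idxE.
have [->|j0] := eqVneq j 0; first by rewrite !idxE /=; ring.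
have [->|j1] := eqVneq j i1; first by rewrite !idxE /=; ring.
by case: eqVneq => _ /=; ring.
Qed.

Lemma fr_e2 Q : fr Q (e i2) = - sin (Q 0 0) *: horoX 1 Q + cos (Q 0 0) *: horoX 2 Q.
Proof.
apply/rowP => j; rewrite !mxE /= !idxE.
have [->|j0] := eqVneq j 0; first by rewrite !idxE /=; ring.
have [->|j1] := eqVneq j i1; first by rewrite !idxE /=; ring.
by case: eqVneq => _ /=; ring.
Qed.

Lemma xi_thetaE Q : xi_theta theta Q = fr Q hxi.
Proof.
by rewrite /hxi frD !frZ fr_e0 fr_e1 scalerDr !(scalerA s) addrA.
Qed.

Lemma f_thetaE t Q : (1 <= t <= n)%N -> f_theta theta t Q = fr Q (hf t).
Proof.
case: t => [//|[|[|t]]] /andP[_ tn].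
- by rewrite /hf frD !frZ fr_e0 fr_e1 scalerDr !(scalerA c) addrA.
- by rewrite /= fr_e2.
- by rewrite /= /horoX /= fr_e// -val_eqE /= !inordK// ltnS (leq_trans _ hn).
Qed.

(** * Smoothness and u-derivatives of the field *)

Lemma smooth_xi : smooth (xi_theta theta : pt R n -> pt R n).
Proof.
move=> k.
have Cu : Ck k (fun Q : pt R n => Q 0 0 : R^o) by exact/Ck_entry/Ck_id.
have [Cc Cs] := Ck_cos_sin Cu.
have CX (i : 'I_n.+1) : Ck k (fun Q : pt R n => expR (- Q 0 0) *: e i).
  apply: (Ck_scale (phi := fun Q : pt R n => expR (- Q 0 0))); last exact: Ck_cst.
  apply: Ck_expR; rewrite (_ : (fun _ => _) = (fun Q : pt R n => -1 * Q 0 0 : R^o)).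
    by apply: Ck_mul => //; exact: Ck_cst.
  by apply/funext => Q; rewrite mulN1r.
apply: Ck_add; last first.
  apply: (Ck_scale (phi := fun Q : pt R n => s * sin (Q 0 0))) => //.
    by apply: Ck_mul => //; exact: Ck_cst.
  exact: CX.
apply: Ck_add; first exact: (Ck_cst k (c *: e 0)).
apply: (Ck_scale (phi := fun Q : pt R n => s * cos (Q 0 0))) => //.
  by apply: Ck_mul => //; exact: Ck_cst.
exact: CX.
Qed.

Lemma dd_height Q (v : pt R n) : dd (fun P : pt R n => P 0 0 : R^o) Q v (v 0 0).
Proof. by apply: dd_entry; exact: dd_id. Qed.

(** The subtracted [phi Q] and [psi Q] come from the factor e^{-u} of X_1 and X_2. *)
Lemma dd_horo_comb (a phi' psi' : R) (phi psi : pt R n -> R^o) Q (v : pt R n) :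
  dd phi Q v (v 0 0 * phi') -> dd psi Q v (v 0 0 * psi') ->
  dd (fun P : pt R n => a *: e 0 + phi P *: horoX 1 P + psi P *: horoX 2 P) Q v
   (v 0 0 *: ((phi' - phi Q) *: horoX 1 Q + (psi' - psi Q) *: horoX 2 Q)).
Proof.
move=> dphi dpsi.
have dX (i : 'I_n.+1) :
    dd (fun P : pt R n => expR (- P 0 0) *: e i) Q v
       (- v 0 0 *: (expR (- Q 0 0) *: e i)).
  have dN := dd_mul (dd_cst (-1 : R^o) Q v) (dd_height Q v).
  apply: (dd_eq (dd_scale (dd_compR dN (is_derive_expR _)) (dd_cst (e i) Q v))).
    by move=> P; rewrite mulN1r.
  by rewrite scaler0 addr0 scalerA mul0r add0r !mulN1r.
apply: (dd_eq (dd_add (dd_add (dd_cst (a *: e 0) Q v)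
   (dd_scale dphi (dX i1))) (dd_scale dpsi (dX i2)))) => //.
by rewrite add0r /horoX /=; apply/rowP => j; rewrite !mxE; ring.
Qed.

Lemma dd_cos_sin (a b : R) Q (v : pt R n) :
  dd (fun P : pt R n => a * cos (P 0 0) + b * sin (P 0 0) : R^o) Q v
    (v 0 0 * (b * cos (Q 0 0) - a * sin (Q 0 0))).
Proof.
have du := dd_height Q v.
apply: (dd_eq (dd_add
  (dd_mul (dd_cst (a : R^o) Q v) (dd_compR du (is_derive_cos _)))
  (dd_mul (dd_cst (b : R^o) Q v) (dd_compR du (is_derive_sin _))))) => //.
ring.
Qed.

Lemma dd_xi Q (v : pt R n) :
  dd (xi_theta theta : pt R n -> pt R n) Q v (v 0 0 *: fr Q hxi1).
Proof.
apply: (dd_eq (dd_horo_comb c _ _ _ _ _ _ (dd_cos_sin s 0 Q v)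
  (dd_cos_sin 0 s Q v))).
  by move=> P; rewrite !mul0r add0r addr0.
rewrite /hxi1 frD !frZ fr_e1 fr_e2; congr (_ *: _).
by apply/rowP => j; rewrite !mxE; ring.
Qed.

Lemma dd_xi1 Q (v : pt R n) :
  dd (fun P => fr P hxi1) Q v (v 0 0 *: fr Q hxi2).
Proof.
apply: (dd_eq (dd_horo_comb 0 _ _ _ _ _ _ (dd_cos_sin (- s) (- s) Q v)
  (dd_cos_sin s (- s) Q v))).
  move=> P; rewrite /hxi1 frD !frZ fr_e1 fr_e2.
  by apply/rowP => j; rewrite !mxE; ring.
rewrite /hxi2 frZ fr_e2; congr (_ *: _).
by apply/rowP => j; rewrite !mxE; ring.
Qed.

(** * Coordinate calculus in the rotating frame *)

Lemma vdot_el (i : 'I_n.+1) h : vdot (e i) h = (i != 0)%:R * h 0 i.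
Proof.
rewrite /vdot; have [->|i0] := eqVneq i 0.
  by rewrite mul0r big1// => j /negbTE j0; rewrite mxE j0 mul0r.
rewrite (bigD1 i)//= mxE !eqxx big1 ?addr0// => j /andP[_ /negbTE ji].
by rewrite mxE ji mul0r.
Qed.

Lemma vdot_er (i : 'I_n.+1) h : vdot h (e i) = (i != 0)%:R * h 0 i.
Proof. by rewrite vdotC vdot_el. Qed.

Definition vdotE := (@vdotDl R n, @vdotDr R n, @vdotZl R n, @vdotZr R n,
  vdot_el, vdot_er).

Lemma vdotNr h k : vdot h (- k) = - vdot h k.
Proof. by rewrite -scaleN1r vdotZr mulN1r. Qed.

Lemma coordZ (r : R) h (i : 'I_n.+1) : (r *: h) 0 i = r * h 0 i.
Proof. by rewrite mxE. Qed.

Lemma coordB h k (i : 'I_n.+1) : (h - k) 0 i = h 0 i - k 0 i.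
Proof. by rewrite !mxE. Qed.

Lemma hxi2_coord : (hxi2 0 0 = 0) * (forall l, vdot hxi2 l = - (2 * s * l 0 i2)).
Proof. by split; move=> *; rewrite ?vdotE ?mxE ?idxE /=; ring. Qed.

Lemma hGam0 h k : hGam h k 0 0 = - vdot h k.
Proof. by rewrite !mxE eqxx /=; ring. Qed.

Lemma hGam_neq0 h k (i : 'I_n.+1) : i != 0 ->
  hGam h k 0 i = h 0 0 * k 0 i + k 0 0 * h 0 i.
Proof. by move=> /negbTE i0; rewrite !mxE i0 /=; ring. Qed.

Lemma vdot_hGaml h k l :
  vdot (hGam h k) l = h 0 0 * vdot k l + k 0 0 * vdot h l.
Proof. by rewrite /hGam -scaleNr !vdotE eqxx /=; ring. Qed.

Lemma vdot_hGamr h k l :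
  vdot l (hGam h k) = h 0 0 * vdot l k + k 0 0 * vdot l h.
Proof. by rewrite vdotC vdot_hGaml !(vdotC l). Qed.

Lemma hxi_coord : (hxi 0 0 = c) * (hxi 0 i1 = s) * (hxi 0 i2 = 0) *
  (forall l, vdot hxi l = s * l 0 i1) * (forall l, vdot l hxi = s * l 0 i1).
Proof.
by do !split; move=> *; rewrite ?vdotE ?mxE ?idxE /=; ring.
Qed.

Lemma hxi1_coord : (hxi1 0 0 = 0) * (hxi1 0 i1 = - s) * (hxi1 0 i2 = s) *
  (forall l, vdot hxi1 l = s * (l 0 i2 - l 0 i1)) *
  (forall l, vdot l hxi1 = s * (l 0 i2 - l 0 i1)).
Proof.
by do !split; move=> *; rewrite ?vdotE ?mxE ?idxE /=; ring.
Qed.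

(* The coordinates of nabla_a xi and of (nabla xi)^* f. *)
Definition hnabla h : pt R n :=
  c *: h + (s * h 0 0) *: e i2 + (- (s * h 0 i1 + c * h 0 0)) *: e 0.

Definition hadj h : pt R n :=
  c *: h + (- (s * h 0 0)) *: e i1 + (s * h 0 i2 - c * h 0 0) *: e 0.

Lemma hnabla_coord h : (hnabla h 0 0 = - (s * h 0 i1)) *
  (hnabla h 0 i1 = c * h 0 i1) * (hnabla h 0 i2 = c * h 0 i2 + s * h 0 0) *
  (forall l, vdot (hnabla h) l = c * vdot h l + s * h 0 0 * l 0 i2) *
  (forall l, vdot l (hnabla h) = c * vdot l h + s * h 0 0 * l 0 i2).
Proof.
by do !split; move=> *; rewrite /hnabla ?vdotE ?mxE ?idxE /=; ring.
Qed.

Lemma hadj_coord h : (hadj h 0 0 = s * h 0 i2) *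
  (hadj h 0 i1 = c * h 0 i1 - s * h 0 0) * (hadj h 0 i2 = c * h 0 i2) *
  (forall l, vdot l (hadj h) = c * vdot l h - s * h 0 0 * l 0 i1).
Proof.
by do !split; move=> *; rewrite /hadj ?vdotE ?mxE ?idxE /=; ring.
Qed.

Local Notation xi := (xi_theta theta : pt R n -> pt R n).
Local Notation xi1 := (fun Q => fr Q hxi1).
Local Notation xi2 := (fun Q => fr Q hxi2).

Lemma dsect_fr Q h : dsect xi Q (fr Q h) = (fr Q h, fr Q (h 0 0 *: hxi1)).
Proof. by rewrite (dsectE _ _ dd_xi) fr0 frZ. Qed.

Lemma sectE Q : sect xi Q = (Q, fr Q hxi).
Proof. by rewrite /sect xi_thetaE. Qed.

Lemma connmap_fr Q x h k :
  connmap g (Q, fr Q x) (fr Q h, fr Q k) = fr Q (k + hGam x h).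
Proof. by rewrite /connmap /= Gam_fr frD. Qed.

Lemma connmap_dsect Q h : connmap g (sect xi Q) (dsect xi Q (fr Q h)) = fr Q (hnabla h).
Proof.
rewrite dsect_fr sectE connmap_fr; congr fr.
rewrite /hGam /hnabla /hxi1 /hxi !vdotE.
by apply/rowP => j; rewrite !mxE !idxE /=; ring.
Qed.

Lemma sasaki_fr p (a b : tpt R n) (a1 b1 ka kb : pt R n) :
  a.1 = fr p.1 a1 -> b.1 = fr p.1 b1 ->
  connmap g p a = fr p.1 ka -> connmap g p b = fr p.1 kb ->
  sasaki g p a b = a1 0 0 * b1 0 0 + vdot a1 b1 + (ka 0 0 * kb 0 0 + vdot ka kb).
Proof. by rewrite /sasaki /dproj => -> -> -> ->; rewrite !ip_fr. Qed.

Lemma dsect_fr1 Q h : (dsect xi Q (fr Q h)).1 = fr Q h.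
Proof. by rewrite dsect_fr. Qed.

Lemma sasaki_dsect Q h k :
  sasaki g (sect xi Q) (dsect xi Q (fr Q h)) (dsect xi Q (fr Q k)) =
  h 0 0 * k 0 0 + vdot h k + s ^+ 2 * h 0 i1 * k 0 i1 + c ^+ 2 * vdot h k
  + c * s * (h 0 0 * k 0 i2 + h 0 i2 * k 0 0) + s ^+ 2 * h 0 0 * k 0 0.
Proof.
rewrite (sasaki_fr (sect xi Q) _ _ h k _ _ (dsect_fr1 Q h) (dsect_fr1 Q k)
  (connmap_dsect Q h) (connmap_dsect Q k)).
rewrite /hnabla !vdotE !mxE !idxE /=.
ring.
Qed.

(* The tangent vector of TM at xi(Q) with horizontal part y and vertical part f. *)
Definition hv Q y f : tpt R n := (fr Q y, fr Q (f - hGam hxi y)).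

Lemma connmap_hv Q y f : connmap g (sect xi Q) (hv Q y f) = fr Q f.
Proof. by rewrite sectE connmap_fr subrK. Qed.

(** The vector [v] is arbitrary and not written in the frame: coordinate vectors [v] identify
    [adj_nabla], and general [v] give the normality of the lifts. The connection map of
    [dsect xi Q v] is nabla_v xi. *)
Lemma ip_adj Q h (v : pt R n) :
  ip g Q (fr Q (hadj h)) v =
  ip g Q (fr Q h) (connmap g (sect xi Q) (dsect xi Q v)).
Proof.
have W : vdot (fr Q hxi) v = s * vdot (fr Q (e i1)) v.
  by rewrite frD !frZ fr_e0 vdotDl !vdotZl vdot_el eqxx /=; ring.
have e0E : ip g Q (fr Q h) (e 0) = h 0 0.
  by rewrite -(fr_e0 Q) ip_fr vdot_er !mxE eqxx /=; ring.
rewrite (dsectE _ _ dd_xi) sectE /connmap /= horo_GamE -scaleNr W fr0.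
rewrite !(horo_ipDr, horo_ipZr) !ip_fr e0E.
rewrite /hadj !frD !frZ fr_e0 !(horo_ipDl, horo_ipZl) !(horo_ip _ (fr Q (e i1))).
rewrite (horo_ip _ (e 0)) !fr0 /hxi /hxi1 !vdotE !mxE !idxE /=.
ring.
Qed.

(** * The second fundamental form in the rotating frame *)

Lemma sasaki_vlift p (x : pt R n) (b : tpt R n) :
  sasaki g p (vlift g p x) b = ip g p.1 x (connmap g p b).
Proof.
rewrite /sasaki connmap_vlift /dproj /= -[X in ip g _ X b.1](scale0r 0).
by rewrite horo_ipZl mul0r add0r.
Qed.

(** [dconnmap] in frame coordinates, with fibre point [x], direction ([a1], [a2]) and base part [b1]
    of the constant vector. Its last term is along [e 0], hence invisible to [vdot]. *)
Definition hdconnmap (x a1 a2 b1 : pt R n) : pt R n :=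
  hGam a2 b1 + (- (2 * a1 0 0 * vdot x b1)) *: e 0.

Lemma hdconnmap0 (x a1 a2 b1 : pt R n) :
  hdconnmap x a1 a2 b1 0 0 = - vdot a2 b1 - 2 * a1 0 0 * vdot x b1.
Proof. by rewrite mxE hGam0 !mxE eqxx /=; ring. Qed.

Lemma vdot_hdconnmap (x a1 a2 b1 l : pt R n) :
  vdot (hdconnmap x a1 a2 b1) l = vdot (hGam a2 b1) l.
Proof. by rewrite /hdconnmap !vdotE eqxx /=; ring. Qed.

Lemma dconnmap_fr p (a b : tpt R n) (x a1 a2 b1 : pt R n) :
  p.2 = fr p.1 x -> a.1 = fr p.1 a1 -> a.2 = fr p.1 a2 -> b.1 = fr p.1 b1 ->
  dconnmap p a b = fr p.1 (hdconnmap x a1 a2 b1).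
Proof.
rewrite /dconnmap /hdconnmap => -> -> -> ->.
rewrite Gam_fr [in RHS]frD [in RHS]frZ fr_e0 fr0 addrC.
by rewrite -(mulrA _ (w _)) vdot_fr.
Qed.

Lemma dsasaki_fr p (a b d : tpt R n) (x a1 a2 b1 d1 kb kd : pt R n) :
  p.2 = fr p.1 x -> a.1 = fr p.1 a1 -> a.2 = fr p.1 a2 ->
  b.1 = fr p.1 b1 -> d.1 = fr p.1 d1 ->
  connmap g p b = fr p.1 kb -> connmap g p d = fr p.1 kd ->
  dsasaki p a b d =
  2 * a1 0 0 * (vdot b1 d1 + vdot kb kd)
  + ((hdconnmap x a1 a2 b1) 0 0 * kd 0 0 + vdot (hdconnmap x a1 a2 b1) kd)
  + (kb 0 0 * (hdconnmap x a1 a2 d1) 0 0 + vdot kb (hdconnmap x a1 a2 d1)).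
Proof.
move=> px ea1 ea2 eb1 ed1 Kb Kd.
have := dconnmap_fr p a b x a1 a2 b1 px ea1 ea2 eb1.
have := dconnmap_fr p a d x a1 a2 d1 px ea1 ea2 ed1.
rewrite /dsasaki Kb Kd => -> ->; rewrite ea1 eb1 ed1 !ip_fr fr0.
by rewrite -(mulrA _ (w _)) mulrDr !vdot_fr.
Qed.

(** The point [Q] drops out. The first term is the one of [xi2]. The others come from half of 2
    [dsasaki] A A nu - [dsasaki] nu A A: the variation of the weight and of the connection map along
    A, then, from the term with factor aa + c^2 aa on, the same along nu. *)
Lemma omega_fr Q y f a :
  omega xi xi2 Q (hv Q y f) (fr Q a) (fr Q a) =
  let aa := vdot a a in let ay := vdot a y in let af := vdot a f in
  let '(a0, a1, a2) := (a 0 0, a 0 i1, a 0 i2) in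
  let '(y0, y1, y2) := (y 0 0, y 0 i1, y 0 i2) in
  let '(f0, f1, f2) := (f 0 0, f 0 i1, f 0 i2) in
  - (2 * s * a0 ^+ 2 * f2) + 2 * a0 * (ay + c * af + s * a0 * f2)
  + s * a0 ^+ 2 * (f2 - f1) - s * a0 * (a1 + a2) * f0
  + s ^+ 2 * a0 * a1 * (y1 + y2) + s * a0 * y0 * (s * a0 + c * a2 - c * a1)
  - y0 * (aa + c ^+ 2 * aa + 2 * c * s * a0 * a2 + s ^+ 2 * a0 ^+ 2)
  - s * a1 * (af - c * ay + s * a1 * y0)
  - (f0 + s * y1) * (c * aa + s * a0 * a2)
  - a0 * c * (af - c * ay - s * a1 * y0) - s * a0 ^+ 2 * (f2 - c * y2).
Proof.
have KA := connmap_dsect Q a; have Kn := connmap_hv Q y f.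
have A1 := dsect_fr1 Q a.
have A2 : (dsect xi Q (fr Q a)).2 = fr Q (a 0 0 *: hxi1) by rewrite dsect_fr.
have p2 : (sect xi Q).2 = fr (sect xi Q).1 hxi := xi_thetaE Q.
rewrite /omega -[(0, _)]/(vlift g (sect xi Q) (fr Q hxi2)).
(* Only the two halves of this vector and its image under the connection map matter from here on. *)
move: (dsect xi Q (fr Q a)) KA A1 A2 => A KA A1 A2.
rewrite christoffel_formE sasaki_vlift Kn fr0.
have n1 : (hv Q y f).1 = fr (sect xi Q).1 y by [].
have n2 : (hv Q y f).2 = fr (sect xi Q).1 (f - hGam hxi y) by [].
rewrite (dsasaki_fr _ _ _ _ _ _ _ _ _ _ _ p2 A1 A2 A1 n1 KA Kn).
rewrite (dsasaki_fr _ _ _ _ _ _ _ _ _ _ _ p2 n1 n2 A1 A1 KA KA).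
rewrite ip_fr.
rewrite !(vdotC (hnabla a) (hdconnmap _ _ _ _)) !vdot_hdconnmap !hdconnmap0.
rewrite !hxi2_coord !vdot_hGaml !hnabla_coord.
rewrite !(coordB f) !vdotZl !(vdotC (f - _)) !vdotDr !vdotNr !vdot_hGamr !coordZ !hGam0.
rewrite !hGam_neq0 ?idxE// !hxi_coord !hxi1_coord.
rewrite !(vdotC y).
by field.

Qed.

(** * The orthonormal normal frame *)

Lemma adj_nabla_fr Q h : adj_nabla g xi Q (fr Q h) = fr Q (hadj h).
Proof.
rewrite /adj_nabla -[RHS](mulmxK (horo_unitmx Q)); congr (_ *m _).
apply/rowP => j.
transitivity (ip g Q (fr Q (hadj h)) (delta_mx 0 j)); last first.
  by rewrite /ip trmx_delta -colE !mxE.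
rewrite mxE ip_adj (dsectE _ _ dd_xi) /connmap /nabla /=.
by have [_ ->] := dd_xi Q (delta_mx 0 j).
Qed.

Lemma hadjZ (r : R) h : hadj (r *: h) = r *: hadj h.
Proof. by apply/rowP => j; rewrite !mxE; ring. Qed.

Lemma hvZ Q (r : R) y f : r *: hv Q y f = hv Q (r *: y) (r *: f).
Proof.
rewrite /hv frZ; congr (_, _).
rewrite -frZ; congr fr; rewrite scalerBr; congr (_ - _).
by rewrite /hGam vdotZr; apply/rowP => j; rewrite !mxE; ring.
Qed.

Lemma lift_hv Q h :
  - hlift g (sect xi Q) (fr Q (hadj h)) + vlift g (sect xi Q) (fr Q h) =
  hv Q (- hadj h) h.
Proof.
have frN k : fr Q (- k) = - fr Q k by rewrite -scaleN1r frZ scaleN1r.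
rewrite /hlift /vlift /hv /= (frD Q h) !frN -Gam_fr frN.
congr (_, _); first by rewrite addr0.
rewrite xi_thetaE -[- fr Q (hadj h)]scaleN1r horo_GamZr scaleN1r.
by rewrite [RHS]addrC.
Qed.

Lemma sasaki_hv Q f k :
  sasaki g (sect xi Q) (hv Q (- hadj f) f) (hv Q (- hadj k) k) =
  f 0 0 * k 0 0 + vdot f k + s ^+ 2 * (f 0 0 * k 0 0 + f 0 i2 * k 0 i2)
  + c ^+ 2 * vdot f k - c * s * (f 0 0 * k 0 i1 + f 0 i1 * k 0 0).
Proof.
have h1 (h : pt R n) : (hv Q (- hadj h) h).1 = fr (sect xi Q).1 (- hadj h) by [].
rewrite (sasaki_fr (sect xi Q) _ _ _ _ _ _ (h1 f) (h1 k) (connmap_hv _ _ _)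
  (connmap_hv _ _ _)).
rewrite -(scaleN1r (hadj f)) -(scaleN1r (hadj k)) vdotZl vdotZr !coordZ.
rewrite !hadj_coord (vdotC (hadj f)) !hadj_coord (vdotC k).
ring.
Qed.

Lemma inord_eq (t u : nat) : (t <= n)%N -> (u <= n)%N ->
  (inord t == inord u :> 'I_n.+1) = (t == u).
Proof. by move=> tn un; rewrite -val_eqE /= !inordK. Qed.

Lemma inord_eq0 (t : nat) : (t <= n)%N -> (inord t == 0 :> 'I_n.+1) = (t == 0%N).
Proof. by move=> tn; rewrite -val_eqE /= inordK. Qed.

Lemma hf_coord (t : nat) : (1 <= t <= n)%N ->
  (hf t 0 0 = - s * (t == 1%N)%:R) * (hf t 0 i1 = c * (t == 1%N)%:R) *
  (hf t 0 i2 = (t == 2)%:R).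
Proof.
move=> /andP[t0 tn].
have n1 : (1 <= n)%N := leq_trans t0 tn.
have [->|t1] := eqVneq t 1%N.
  by do !split; rewrite /hf !mxE !idxE /=; ring.
have -> : hf t = e (inord t) by case: t t0 t1 {tn} => [|[|t]].
do !split; rewrite mxE /=; rewrite ?(eq_sym 0) ?(eq_sym i1) ?(eq_sym i2).
- by rewrite inord_eq0// gtn_eqF// mulr0.
- by rewrite inord_eq// (negbTE t1) mulr0.
- by rewrite inord_eq.
Qed.

Lemma vdot_hf (t u : nat) : (1 <= t <= n)%N -> (1 <= u <= n)%N ->
  vdot (hf t) (hf u) = (t == u)%:R * (if t == 1%N then c ^+ 2 else 1).
Proof.
move=> ht hu; have [t0 tn] := andP ht; have [u0 un] := andP hu.
have hfE (m : nat) : (1 <= m)%N -> m != 1%N -> hf m = e (inord m).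
  by case: m => [|[|m]].
have [->|t1] := eqVneq t 1%N.
  rewrite /hf vdotDl !vdotZl !vdot_el !idxE /= !(hf_coord _ hu) (eq_sym 1%N).
  by ring.
rewrite (hfE t)// vdot_el inord_eq0// gtn_eqF//= mul1r mulr1.
have [->|u1] := eqVneq u 1%N.
  rewrite /hf !mxE /= inord_eq0// (inord_eq _ _ tn (leq_trans t0 tn)).
  by rewrite (negbTE t1) gtn_eqF//=; ring.
by rewrite (hfE u)// mxE /= inord_eq.
Qed.

(** The squared length of the lift before normalization, that is 1 plus the squared length of the
    adjoint applied to f_t. The adjoint sends f_1 to E_1 and f_2 to sin theta X_0 + cos theta E_2,
    both unit vectors, and multiplies every other f_t by cos theta. *)
Definition sqN (t : nat) : R := if (t <= 2)%N then 2 else 1 + c ^+ 2.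

Lemma cosE : c ^+ 2 = 1 - s ^+ 2.
Proof. by rewrite -(cos2Dsin2 theta) addrK. Qed.

Lemma sqN_gt0 t : 0 < sqN t.
Proof. by rewrite /sqN; case: ifP => _ //; rewrite ltr_wpDr// sqr_ge0. Qed.

Lemma sasaki_hf Q (t u : nat) : (1 <= t <= n)%N -> (1 <= u <= n)%N ->
  sasaki g (sect xi Q) (hv Q (- hadj (hf t)) (hf t)) (hv Q (- hadj (hf u)) (hf u))
  = (t == u)%:R * sqN t.
Proof.
move=> ht hu; rewrite sasaki_hv vdot_hf// !hf_coord// /sqN.
have [<-|tu] := eqVneq t u.
  have [->|t1] := eqVneq t 1%N; first by rewrite /=; ring: cosE.
  have [->|t2] := eqVneq t 2; first by rewrite /=; ring: cosE.
  rewrite (_ : (t <= 2)%N = false) /=; first by ring.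
  by case/andP: ht; case: t t1 t2 {hu} => [|[|[|t]]].
have [t1|t1] := eqVneq t 1%N.
  have -> : (u == 1%N) = false by rewrite -t1 eq_sym (negbTE tu).
  by rewrite t1 /=; ring.
have [t2|t2] := eqVneq t 2.
  have -> : (u == 2) = false by rewrite -t2 eq_sym (negbTE tu).
  by rewrite /=; ring.
by rewrite /=; ring.
Qed.

Definition nf (t : nat) : pt R n := (Num.sqrt (sqN t))^-1 *: hf t.

Lemma n_thetaE t Q : (1 <= t <= n)%N ->
  n_theta theta t Q = hv Q (- hadj (nf t)) (nf t).
Proof.
move=> ht; rewrite /n_theta /normal_lift f_thetaE// adj_nabla_fr lift_hv.
by rewrite sasaki_hf// eqxx mul1r hvZ /nf hadjZ scalerN.
Qed.

Lemma nf_perp t : (1 <= t <= n)%N -> c * nf t 0 0 + s * nf t 0 i1 = 0.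
Proof. by move=> ht; rewrite !coordZ !hf_coord//; ring. Qed.

(** The hypothesis is orthogonality of [h] to xi; tangency to T_1 M constrains only the vertical
    part. *)
Lemma tangent_hv Q h : c * h 0 0 + s * h 0 i1 = 0 ->
  tangent_T1 g (sect xi Q) (hv Q (- hadj h) h).
Proof.
move=> hp; apply/tangent_T1E; rewrite connmap_hv.
rewrite -[(sect xi Q).2]/(xi Q) xi_thetaE ip_fr !hxi_coord -hp.
by ring.
Qed.

(** The horizontal parts contribute minus the product of the adjoint of [h] with [v], the vertical
    parts the product of [h] with nabla_v xi; these cancel by adjointness. *)
Lemma normal_hv Q h (v : pt R n) :
  sasaki g (sect xi Q) (hv Q (- hadj h) h) (dsect xi Q v) = 0.
Proof.
rewrite /sasaki connmap_hv -ip_adj /dproj /= (dsectE _ _ dd_xi) /=.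
by rewrite -[- hadj h]scaleN1r frZ horo_ipZl; ring.
Qed.

Lemma orthonormal_n_theta :
  orthonormal_normal_frame g xi (n_theta theta : nat -> pt R n -> tpt R n).
Proof.
move=> Q t ht; split=> [|v|u hu].
- by rewrite n_thetaE//; apply: tangent_hv; exact: nf_perp.
- by rewrite n_thetaE// normal_hv.
have nfE m : (1 <= m <= n)%N -> n_theta theta m Q =
    (Num.sqrt (sqN m))^-1 *: hv Q (- hadj (hf m)) (hf m).
  by move=> hm; rewrite n_thetaE// /nf hadjZ hvZ scalerN.
rewrite !nfE// horo_sasakiZl horo_sasakiZr sasaki_hf//.
have [<-|_] := eqVneq t u; last by rewrite !(mul0r, mulr0).
rewrite mul1r mulrA -invfM -expr2 sqr_sqrtr ?ltW ?sqN_gt0//.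
by rewrite mulVf// gt_eqF ?sqN_gt0.
Qed.

Lemma unit_xi : unit_vector_field g xi.
Proof.
split=> [|Q]; first exact: smooth_xi.
by rewrite xi_thetaE ip_fr !hxi_coord -(cos2Dsin2 theta); ring.
Qed.

(* The images of these vectors under the differential of xi are orthonormal. *)
Definition hE (i : 'I_n.+1) : pt R n :=
  if i == 0 then c *: e 0 + (- s) *: e i2
  else if i == i1 then (Num.sqrt 2)^-1 *: e i1
  else if i == i2 then (Num.sqrt 2)^-1 *: (s *: e 0 + c *: e i2)
  else (Num.sqrt (1 + c ^+ 2))^-1 *: e i.

Lemma hE0_coord : (hE 0 0 0 = c) * (hE 0 0 i1 = 0) * (hE 0 0 i2 = - s) *
  (forall l, vdot (hE 0) l = - s * l 0 i2).
Proof.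
by rewrite /hE eqxx; do !split; move=> *; rewrite ?vdotE ?mxE ?idxE /=; ring.
Qed.

Lemma hE1_coord : (hE i1 0 0 = 0) * (hE i1 0 i1 = (Num.sqrt 2)^-1) *
  (hE i1 0 i2 = 0) * (forall l, vdot (hE i1) l = (Num.sqrt 2)^-1 * l 0 i1).
Proof.
by rewrite /hE !idxE; do !split; move=> *; rewrite ?vdotE ?mxE ?idxE /=; ring.
Qed.

Lemma hE2_coord : (hE i2 0 0 = (Num.sqrt 2)^-1 * s) * (hE i2 0 i1 = 0) *
  (hE i2 0 i2 = (Num.sqrt 2)^-1 * c) *
  (forall l, vdot (hE i2) l = (Num.sqrt 2)^-1 * c * l 0 i2).
Proof.
by rewrite /hE !idxE; do !split; move=> *; rewrite ?vdotE ?mxE ?idxE /=; ring.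
Qed.

Lemma hE_coord (i : 'I_n.+1) : i != 0 -> i != i1 -> i != i2 ->
  (hE i 0 0 = 0) * (hE i 0 i1 = 0) * (hE i 0 i2 = 0) *
  (forall j, hE j 0 i = (j == i)%:R * (Num.sqrt (1 + c ^+ 2))^-1) *
  (forall l, vdot (hE i) l = (Num.sqrt (1 + c ^+ 2))^-1 * l 0 i).
Proof.
move=> i0 j1 j2.
have hEi : hE i = (Num.sqrt (1 + c ^+ 2))^-1 *: e i.
  by rewrite /hE (negbTE i0) (negbTE j1) (negbTE j2).
have hEj j : hE j 0 i = (j == i)%:R * (Num.sqrt (1 + c ^+ 2))^-1.
  have [->|ji] := eqVneq j i; first by rewrite hEi !mxE !eqxx mulr1 mul1r.
  rewrite /hE; do 3?case: ifP => _; rewrite !mxE ?(eq_sym i j) ?(negbTE i0)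
    ?(negbTE j1) ?(negbTE j2) ?(negbTE ji) /=; ring.
do !split => //; rewrite ?hEi; move=> *.
- by rewrite !mxE eqxx /= (eq_sym 0) (negbTE i0) mulr0.
- by rewrite !mxE eqxx /= (eq_sym i1) (negbTE j1) mulr0.
- by rewrite !mxE eqxx /= (eq_sym i2) (negbTE j2) mulr0.
- by rewrite vdotZl vdot_el i0 mul1r.
Qed.

Lemma sqrt2V : (Num.sqrt 2)^-1 ^+ 2 = 2^-1 :> R.
Proof. by rewrite exprVn sqr_sqrtr. Qed.

Lemma c2_gt0 : 0 < 1 + c ^+ 2.
Proof. by rewrite ltr_wpDr// sqr_ge0. Qed.

Lemma sqrtcV : (Num.sqrt (1 + c ^+ 2))^-1 ^+ 2 = (1 + c ^+ 2)^-1.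
Proof. by rewrite exprVn sqr_sqrtr// ltW// c2_gt0. Qed.

Lemma coord_cases (P : 'I_n.+1 -> Prop) : P 0 -> P i1 -> P i2 ->
  (forall i, i != 0 -> i != i1 -> i != i2 -> P i) -> forall i, P i.
Proof.
move=> P0 P1 P2 P3 i; have [->//|i0] := eqVneq i 0.
have [->//|j1] := eqVneq i i1; have [->//|j2] := eqVneq i i2.
exact: P3.
Qed.

Lemma orthonormal_hE Q (i j : 'I_n.+1) :
  sasaki g (sect xi Q) (dsect xi Q (fr Q (hE i))) (dsect xi Q (fr Q (hE j)))
  = (i == j)%:R.
Proof.
have p2 : 2 * (Num.sqrt 2)^-1 ^+ 2 = 1 :> R by rewrite sqrt2V divff.
have q2 : (Num.sqrt (1 + c ^+ 2))^-1 ^+ 2 * (1 + c ^+ 2) = 1.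
  by rewrite sqrtcV mulVf// gt_eqF// c2_gt0.
(* The same relation with a monomial on the left, as [ring] needs it for rewriting. *)
have q2' : c ^+ 2 * (Num.sqrt (1 + c ^+ 2))^-1 ^+ 2 =
    1 - (Num.sqrt (1 + c ^+ 2))^-1 ^+ 2 by rewrite -[X in _ = X - _]q2; ring.
rewrite sasaki_dsect.
move: i j; apply: coord_cases => [|||i i0 j1 j2]; apply: coord_cases => [|||j k0 k1 k2].
- by rewrite !hE0_coord ?idxE /=; ring: cosE p2 q2'.
- by rewrite !hE0_coord !hE1_coord ?idxE /=; ring: cosE p2 q2'.
- by rewrite !hE0_coord !hE2_coord ?idxE /=; ring: cosE p2 q2'.
- by rewrite !hE0_coord !(hE_coord _ k0 k1 k2) (eq_sym 0) (negbTE k0) /=;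
    ring: cosE p2 q2'.
- by rewrite !hE1_coord !hE0_coord ?idxE /=; ring: cosE p2 q2'.
- by rewrite !hE1_coord ?idxE /=; ring: cosE p2 q2'.
- by rewrite !hE1_coord !hE2_coord ?idxE /=; ring: cosE p2 q2'.
- by rewrite !hE1_coord !(hE_coord _ k0 k1 k2) (eq_sym i1) (negbTE k1) /=;
    ring: cosE p2 q2'.
- by rewrite !hE2_coord !hE0_coord ?idxE /=; ring: cosE p2 q2'.
- by rewrite !hE2_coord !hE1_coord ?idxE /=; ring: cosE p2 q2'.
- by rewrite !hE2_coord ?idxE /=; ring: cosE p2 q2'.
- by rewrite !hE2_coord !(hE_coord _ k0 k1 k2) (eq_sym i2) (negbTE k2) /=;
    ring: cosE p2 q2'.
- by rewrite !(hE_coord _ i0 j1 j2) !hE0_coord (eq_sym 0) (negbTE i0) /=;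
    ring: cosE p2 q2'.
- by rewrite !(hE_coord _ i0 j1 j2) !hE1_coord (eq_sym i1) (negbTE j1) /=;
    ring: cosE p2 q2'.
- by rewrite !(hE_coord _ i0 j1 j2) !hE2_coord (eq_sym i2) (negbTE j2) /=;
    ring: cosE p2 q2'.
- by rewrite !(hE_coord _ i0 j1 j2) !(hE_coord _ k0 k1 k2) (eq_sym j) /=;
    ring: q2'.
Qed.

(** The four kinds of frame vectors contribute s f_2 - s f_1, s f_2, s f_1 and, n - 2 times, s f_2 +
    2 s f_1 / (1 + c^2), where f_1 and f_2 are the coordinates of [f] at [i1] and [i2]. *)
Lemma sum_omega Q (f : pt R n) : c * f 0 0 + s * f 0 i1 = 0 ->
  \sum_i omega xi xi2 Q (hv Q (- hadj f) f) (fr Q (hE i)) (fr Q (hE i)) =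
  n%:R * s * f 0 i2 + 2 * (n%:R - 2) * s * f 0 i1 / (1 + c ^+ 2).
Proof.
move=> perp.
have perp1 : c * f 0 0 = - (s * f 0 i1) by apply/eqP; rewrite -subr_eq0 opprK perp.
(* [perp1] and [cosE] reduce c^2 f_0 in two different ways; [perp2] is the resulting relation, added
   so that [ring] can rewrite with it too. *)
have perp2 : c * s * f 0 i1 = s ^+ 2 * f 0 0 - f 0 0.
  rewrite -mulrA (_ : s * _ = - (c * f 0 0)); last by rewrite perp1 opprK.
  by ring: cosE.
pose om h := omega xi xi2 Q (hv Q (- hadj f) f) (fr Q h) (fr Q h).
have om_rest i : i != 0 -> i != i1 -> i != i2 -> om (hE i) =
    (s * f 0 i2 * (1 + c ^+ 2) + 2 * s * f 0 i1) / (1 + c ^+ 2).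
  move=> i0 j1 j2; rewrite /om omega_fr /= !(hE_coord _ i0 j1 j2) eqxx.
  rewrite -(scaleN1r (hadj f)) !coordZ !hadj_coord -sqrtcV /=.
  by ring: perp1 cosE perp2.
have p2 : 2 * (Num.sqrt 2)^-1 ^+ 2 = 1 :> R by rewrite sqrt2V divff.
have o0 : om (hE 0) = s * f 0 i2 - s * f 0 i1.
  rewrite /om omega_fr /= !hE0_coord.
  rewrite -(scaleN1r (hadj f)) !coordZ !hadj_coord.
  by ring: perp1 cosE perp2.
have o1 : om (hE i1) = s * f 0 i2.
  rewrite /om omega_fr /= !hE1_coord.
  rewrite -(scaleN1r (hadj f)) !coordZ !hadj_coord.
  transitivity (2 * (Num.sqrt 2)^-1 ^+ 2 * (s * f 0 i2)); last by rewrite p2 mul1r.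
  by ring: perp1 cosE perp2.
have o2 : om (hE i2) = s * f 0 i1.
  rewrite /om omega_fr /= !hE2_coord.
  rewrite -(scaleN1r (hadj f)) !coordZ !hadj_coord.
  transitivity (2 * (Num.sqrt 2)^-1 ^+ 2 * (s * f 0 i1)); last by rewrite p2 mul1r.
  by ring: perp1 cosE perp2.
(* Summing 1 over the n nonzero indices through [big_coords] counts the indices other than 0, [i1]
   and [i2]. *)
have card_rest : \sum_(i < n.+1 | [&& i != 0, i != i1 & i != i2]) 1 = n%:R - 2 :> R.
  have := big_coords (fun=> 1); rewrite sumr_const cardC1 card_ord /= => ->.
  by ring.
rewrite -[LHS]/(\sum_i om (hE i)) (bigD1 0)//= big_coords.
have -> : \sum_(i < n.+1 | [&& i != 0, i != i1 & i != i2]) om (hE i) =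
    (s * f 0 i2 * (1 + c ^+ 2) + 2 * s * f 0 i1) / (1 + c ^+ 2) * (n%:R - 2).
  rewrite -card_rest big_distrr; apply: eq_bigr => i /and3P[i0 j1 j2] /=.
  by rewrite om_rest// mulr1.
by rewrite o0 o1 o2; field; rewrite gt_eqF// c2_gt0.
Qed.

Lemma mean_curv_n_theta D F Q t : levi_civita_T1 g D ->
  frame_extension g xi F -> (1 <= t <= n)%N ->
  mean_curv g D xi F Q (n_theta theta t Q) = (n.+1%:R)^-1 * (Num.sqrt (sqN t))^-1
    * (n%:R * s * (t == 2)%:R
       + 2 * (n%:R - 2) * s * c * (t == 1%N)%:R / (1 + c ^+ 2)).
Proof.
move=> lcD fF ht; rewrite n_thetaE//.
rewrite (mean_curv_orthonormal _ lcD _ _ _ unit_xi dd_xi dd_xi1 _ _ _ _ fF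
  (tangent_hv _ _ (nf_perp _ ht)) (orthonormal_hE Q)).
rewrite (sum_omega _ _ (nf_perp _ ht)) !coordZ !hf_coord//.
by ring.
Qed.

End MeanCurvature.

Theorem proposition3p6p2 (R : realType) (n : nat) (theta : R)
    (hn : (2 <= n)%N) (htheta : 0 <= theta <= pi / 2) :
  let g := horo_metric R n in
  let xi : pt R n -> pt R n := xi_theta theta in
  let nu : nat -> pt R n -> tpt R n := n_theta theta in
  [/\ unit_vector_field g xi,
      orthonormal_normal_frame g xi nu &
      forall D, levi_civita_T1 g D ->
      forall F, frame_extension g xi F ->
        constant_mean_curvature g D xi F nu /\
        forall Q : pt R n,
        [/\ mean_curv g D xi F Q (nu 1%N Q) =
              (n%:R - 2) / (n%:R + 1) *
              (Num.sqrt 2 * sin theta * cos theta / (1 + cos theta ^+ 2)),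
            mean_curv g D xi F Q (nu 2%N Q) =
              n%:R * Num.sqrt 2 * sin theta / (2 * (n%:R + 1)) &
            forall s : nat, (3 <= s <= n)%N ->
              mean_curv g D xi F Q (nu s Q) = 0]].
Proof.
move=> g xi nu; split; [exact: unit_xi|exact: orthonormal_n_theta|].
move=> D lcD F fF.
have H Q t := mean_curv_n_theta theta hn D F Q t lcD fF.
have sqrt2_neq0 : Num.sqrt 2 != 0 :> R by rewrite gt_eqF// sqrtr_gt0.
(* The stated values carry sqrt 2 in the numerator, while the normalization of the normals puts it
   in the denominator. *)
have sqrt2V : (Num.sqrt 2)^-1 = Num.sqrt 2 / 2 :> R.
  by apply: (mulfI sqrt2_neq0); rewrite mulfV// mulrA -expr2 sqr_sqrtr// divff.
have n1_neq0 : n%:R + 1 != 0 :> R by rewrite natr1 pnatr_eq0.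
have c2_neq0 : 1 + cos theta ^+ 2 != 0 by rewrite gt_eqF// c2_gt0.
(* The value given by [H] does not mention [Q], so it serves as the constant. *)
split; first by eexists => Q t ht; rewrite /nu H.
move=> Q; split=> [||t /andP[t3 tn]].
- rewrite /nu H ?(leq_trans _ hn)// /sqN /= -natr1 sqrt2V.
  by field; rewrite n1_neq0 c2_neq0.
- rewrite /nu H// /sqN /= -natr1 sqrt2V.
  by field; rewrite n1_neq0 c2_neq0.
rewrite /nu H ?tn ?andbT; last exact: leq_trans t3.
by rewrite (gtn_eqF t3) (gtn_eqF (ltnW t3)) !mulr0 mul0r addr0 mulr0.
Qed.
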